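(* Let $A$ be a commutative $\mathbb C$-algebra with unit, let $\mathfrak g=sl_{r+1}$ with vector representation $V_{r+1}$ and first fundamental weight $\omega_1$, and let $n$ be a non-negative integer. Then there is a natural isomorphism of $sl_{r+1}\otimes A$-modules $$W_A(n\omega_1)\cong S^n(V_{r+1}\otimes A),$$ where $W_A(n\omega_1)$ is the global Weyl module and $S^n$ denotes the $n$-th symmetric power over $\mathbb C$.
   Context: All vector spaces and algebras are over $\mathbb C$. For $\mathfrak g=sl_{r+1}$ ($r\ge1$) let $\mathfrak h$ be the Cartan subalgebra, $\mathfrak n_+$ the positive nilpotent subalgebra, $h_1,\dots,h_r$ the simple coroots, $P\subset\mathfrak h^*$ the weight lattice; $\omega_1(h_1)=1$ and $\omega_1(h_i)=0$ for $i>1$. A $\mathfrak g$-module $V$ is integrable if there is a finite subset $D\subset P$ with $V=\bigoplus_{\mu\in D}V^\mu$, where each $h\in\mathfrak h$ acts on $V^\mu$ by the scalar $\mu(h)$ (the spaces $V^\mu$ may be infinite-dimensional). A $\mathfrak g\otimes A$-module is $\mathfrak g\otimes1$-integrable if it is integrable over $\mathfrak g\cong\mathfrak g\otimes 1$. The bracket on $\mathfrak g\otimes A$ is $[x\otimes P,y\otimes Q]=[x,y]\otimes PQ$. The global Weyl module $W_A(\lambda)$, $\lambda\in\mathfrak h^*$, is the maximal $\mathfrak g\otimes 1$-integrable $\mathfrak g\otimes A$-module generated by a vector $v_\lambda$ with $(\mathfrak n_+\otimes P)v_\lambda=0$ for all $P\in A$ and $(h\otimes1)v_\lambda=\lambda(h)v_\lambda$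 for all $h\in\mathfrak h$. ''Maximal'' means that any other such module is a quotient of it (generator mapping to generator). $sl_{r+1}\otimes A$ acts on $V_{r+1}\otimes A$ by $(g\otimes P)(w\otimes Q)=gw\otimes PQ$ and on $S^n(V_{r+1}\otimes A)$ by the induced (derivation) action. The natural map is the one sending $v_{n\omega_1}$ to the $n$-th symmetric power of $v\otimes1$, where $v$ is the highest weight vector of $V_{r+1}$. *)

(* Defs.v *)
From HB Require Import structures.
From mathcomp Require Import all_boot all_order all_algebra.
From mathcomp Require Import ring.
From mathcomp Require Import perm finmap generic_quotient ring_quotient.
From mathcomp.classical Require Import boolp.
From mathcomp.reals Require Import reals.
From mathcomp.real_closed Require Import complex.
From mathcomp.multinomials Require Import monalg.

Set Implicit Arguments.
Unset Strict Implicit.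
Unset Printing Implicit Defensive.

Import GRing.Theory.
Local Open Scope ring_scope.
Local Open Scope quotient_scope.

Section LinearFacts.
Variables (K : fieldType) (U V : lmodType K) (f : U -> V).
Hypothesis lin_f : linear f.
Lemma linear_fun0 : f 0 = 0.
Proof. by have := lin_f (-1) 0 0; rewrite scaler0 addr0 scaleN1r addNr. Qed.
Lemma linear_funD u v : f (u + v) = f u + f v.
Proof. by have := lin_f 1 u v; rewrite !scale1r. Qed.
Lemma linear_funZ a u : f (a *: u) = a *: f u.
Proof. by have := lin_f a u 0; rewrite !addr0 linear_fun0 addr0. Qed.
Lemma linear_funN u : f (- u) = - f u.
Proof. by rewrite -scaleN1r linear_funZ scaleN1r. Qed.
Lemma linear_funB u v : f (u - v) = f u - f v.
Proof. by rewrite linear_funD linear_funN. Qed.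
Lemma linear_fun_sum I (r : seq I) (P : pred I) (F : I -> U) :
  f (\sum_(i <- r | P i) F i) = \sum_(i <- r | P i) f (F i).
Proof. exact: (big_morph f linear_funD linear_fun0). Qed.
End LinearFacts.

Section Span.
Variables (K : fieldType) (V : lmodType K).

Definition is_subspace (W : V -> Prop) : Prop :=
  W 0 /\ forall a u v, W u -> W v -> W (a *: u + v).

Definition spanned (S : V -> Prop) : {pred V} :=
  fun v => `[< forall W, is_subspace W -> (forall s, S s -> W s) -> W v >].

Variable S : V -> Prop.

Lemma spannedP v : reflect
  (forall W, is_subspace W -> (forall s, S s -> W s) -> W v) (v \in spanned S).
Proof. exact: asboolP. Qed.

Fact spanned_zmod_closed : zmod_closed (spanned S).
Proof.
split=> [|u v /spannedP uS /spannedP vS]; apply/spannedP => W sW SW.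
  by case: sW.
rewrite addrC -scaleN1r; case: (sW) => _; apply; [exact: vS|exact: uS].
Qed.
HB.instance Definition _ := GRing.isZmodClosed.Build V (spanned S)
  spanned_zmod_closed.

Lemma spannedZ a v : v \in spanned S -> a *: v \in spanned S.
Proof.
move=> /spannedP vS; apply/spannedP => W sW SW.
by rewrite -[a *: v]addr0; case: (sW) => W0; apply=> //; apply: vS.
Qed.

Lemma spanned_gen s : S s -> s \in spanned S.
Proof. by move=> Ss; apply/spannedP => W _; apply. Qed.

(* S need not be a subspace: the quotient is by its linear span. *)
Definition lquot : Type := Quotient.quot (spanned S).
HB.instance Definition _ := GRing.Zmodule.on lquot.

Definition lproj (v : V) : lquot := \pi v.

Lemma lproj_repr (x : lquot) : lproj (repr x) = x.
Proof. exact: reprK. Qed.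

Lemma lproj_eq u v : (lproj u == lproj v) = (u - v \in spanned S).
Proof. by rewrite Quotient.idealrBE. Qed.

Lemma lprojD u v : lproj (u + v) = lproj u + lproj v.
Proof. exact: (@Quotient.pi_add V (spanned S)). Qed.

Definition lscale (a : K) (x : lquot) : lquot := lproj (a *: repr x).

Lemma lprojZ_subproof a v : lproj (a *: v) = lscale a (lproj v).
Proof.
apply/eqP; rewrite lproj_eq -scalerBr; apply: spannedZ.
by rewrite -lproj_eq lproj_repr.
Qed.

Fact lscaleA a b x : lscale a (lscale b x) = lscale (a * b) x.
Proof. by rewrite -[x]lproj_repr -!lprojZ_subproof scalerA. Qed.
Fact lscale1 : left_id 1 lscale.
Proof. by move=> x; rewrite -[x]lproj_repr -!lprojZ_subproof scale1r. Qed.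
Fact lscaleDr : right_distributive lscale +%R.
Proof.
move=> a x y; rewrite -[x]lproj_repr -[y]lproj_repr.
by rewrite -lprojD -!lprojZ_subproof scalerDr lprojD.
Qed.
Fact lscaleDl x : {morph lscale^~ x : a b / a + b}.
Proof.
by move=> a b; rewrite -[x]lproj_repr -!lprojZ_subproof scalerDl lprojD.
Qed.
HB.instance Definition _ :=
  GRing.Zmodule_isLmodule.Build K lquot lscaleA lscale1 lscaleDr lscaleDl.

Fact lproj_linear : linear lproj.
Proof. by move=> a u v; rewrite lprojD lprojZ_subproof. Qed.
HB.instance Definition _ :=
  GRing.isLinear.Build K V lquot _ lproj lproj_linear.

Lemma lproj_rel s : S s -> lproj s = 0.
Proof.
by move=> Ss; apply/eqP; rewrite -(linear0 lproj) lproj_eq subr0 spanned_gen.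
Qed.

Lemma lproj_rel2 u v : S (u - v) -> lproj u = lproj v.
Proof. by move=> Suv; apply/eqP; rewrite lproj_eq spanned_gen. Qed.

Lemma lquot_ind (P : lquot -> Prop) : (forall v, P (lproj v)) -> forall x, P x.
Proof. by move=> Pp x; rewrite -[x]lproj_repr. Qed.

Section Lift.
Variables (M : lmodType K) (f : V -> M).
Hypotheses (lin_f : linear f) (fS : forall s, S s -> f s = 0).

Lemma lquot_liftE v : f (repr (lproj v)) = f v.
Proof.
apply/eqP; rewrite -subr_eq0 -(linear_funB lin_f); apply/eqP.
have /spannedP inS : repr (lproj v) - v \in spanned S.
  by rewrite -lproj_eq lproj_repr.
apply: (inS (fun u => f u = 0)) => //; split=> [|a u w fu fw]; first exact: linear_fun0.
by rewrite lin_f fu fw scaler0 addr0.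
Qed.

Lemma lquot_lift_linear : linear (fun x : lquot => f (repr x)).
Proof.
move=> a; elim/lquot_ind => u; elim/lquot_ind => v.
by rewrite -linearP !lquot_liftE lin_f.
Qed.
End Lift.
End Span.

Section FreeLift.
Variables (K : fieldType) (X : choiceType) (M : lmodType K) (h : X -> M).

Definition free_lift (p : {malg K[X]}) : M := \sum_(x <- msupp p) p@_x *: h x.

Lemma free_liftEw (d : {fset X}) p : (msupp p `<=` d)%fset ->
  free_lift p = \sum_(x <- d) p@_x *: h x.
Proof.
move=> sub; rewrite /free_lift (big_fset_incl _ sub) //= => x _ /mcoeff_outdom ->.
by rewrite scale0r.
Qed.

Lemma free_liftU x : free_lift << x >> = h x.
Proof.
rewrite (free_liftEw (d := [fset x]%fset)) ?msuppU_le //.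
by rewrite big_seq_fset1 mcoeffUU scale1r.
Qed.

Lemma free_lift_linear : linear free_lift.
Proof.
move=> a p q; pose d := (msupp p `|` msupp q)%fset.
have sp : (msupp p `<=` d)%fset by apply: fsubsetUl.
have sq : (msupp q `<=` d)%fset by apply: fsubsetUr.
have sa : (msupp (a *: p + q) `<=` d)%fset.
  apply: fsubset_trans (msuppD_le _ _) _.
  by rewrite fsubUset sq andbT (fsubset_trans (msuppZ_le _ _)).
rewrite (free_liftEw sp) (free_liftEw sq) (free_liftEw sa).
rewrite scaler_sumr -big_split /=; apply: eq_bigr => x _.
by rewrite mcoeffD mcoeffZ scalerDl scalerA.
Qed.
End FreeLift.

Lemma malg_ind (K : fieldType) (X : choiceType) (W : {malg K[X]} -> Prop) :
  is_subspace W -> (forall x, W << x >>) -> forall p, W p.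
Proof.
move=> [W0 Wl] Wx p; rewrite [p]monalgE; elim: (msupp p : seq X) => [|x s IH].
  by rewrite big_nil.
rewrite big_cons; have -> : << p@_x *g x >> = p@_x *: << x >> :> {malg K[X]}.
  by apply/malgP => y; rewrite mcoeffZ !mcoeffU mulrnAr mulr1.
exact: Wl.
Qed.

Section Tensor.
Variables (K : fieldType) (U V : lmodType K).

Inductive tensor_rel : {malg K[(U * V)%type]} -> Prop :=
| tensor_rel_l a u1 u2 v : tensor_rel
    (<< (a *: u1 + u2, v) >> - (a *: << (u1, v) >> + << (u2, v) >>))
| tensor_rel_r a u v1 v2 : tensor_rel
    (<< (u, a *: v1 + v2) >> - (a *: << (u, v1) >> + << (u, v2) >>)).

Definition tensor : Type := lquot tensor_rel.
HB.instance Definition _ := GRing.Lmodule.on tensor.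

Definition tens (u : U) (v : V) : tensor := lproj tensor_rel << (u, v) >>.

Lemma tens_linl v : linear (tens^~ v).
Proof.
move=> a u1 u2; rewrite /tens -lproj_linear.
by apply: lproj_rel2; exact: tensor_rel_l.
Qed.
Lemma tens_linr u : linear (tens u).
Proof.
move=> a u1 u2; rewrite /tens -lproj_linear.
by apply: lproj_rel2; exact: tensor_rel_r.
Qed.

Lemma tensor_ind (W : tensor -> Prop) :
  is_subspace W -> (forall u v, W (tens u v)) -> forall t, W t.
Proof.
move=> [W0 Wl] Wt; elim/lquot_ind; apply: malg_ind => [|[u v]]; last exact: Wt.
by split=> [|a p q Wp Wq]; rewrite ?linear0 ?linearP //; apply: Wl.
Qed.

Section Lift.
Variables (M : lmodType K) (b : U -> V -> M).

Definition tensor_lift (t : tensor) : M :=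
  free_lift (fun p => b p.1 p.2) (repr t).

Hypotheses (b_linl : forall v, linear (b^~ v)) (b_linr : forall u, linear (b u)).

Let lift_rel s : tensor_rel s -> free_lift (fun p => b p.1 p.2) s = 0.
Proof.
have lf := @free_lift_linear K _ _ (fun p : (U * V)%type => b p.1 p.2).
by case=> *; rewrite (linear_funB lf) lf !free_liftU /= ?b_linl ?b_linr subrr.
Qed.

Lemma tensor_liftE u v : tensor_lift (tens u v) = b u v.
Proof.
by rewrite /tensor_lift lquot_liftE ?free_liftU //; exact: free_lift_linear.
Qed.
Lemma tensor_lift_linear : linear tensor_lift.
Proof. by apply: lquot_lift_linear => //; exact: free_lift_linear. Qed.
End Lift.
End Tensor.
Notation "U ⊗ V" := (tensor U V) (at level 40, left associativity) : type_scope.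
Notation "u ⊗t v" := (tens u v) (at level 40, left associativity) : ring_scope.

Section SymmetricPower.
Variables (K : fieldType) (n : nat) (V : lmodType K).

Definition upd (f : {ffun 'I_n -> V}) (i : 'I_n) (v : V) : {ffun 'I_n -> V} :=
  [ffun j => if j == i then v else f j].

(* The generator << f >> stands for the product f 0 · ... · f (n-1). *)
Inductive symp_rel : {malg K[{ffun 'I_n -> V}]} -> Prop :=
| symp_rel_lin f i a u v : symp_rel
    (<< upd f i (a *: u + v) >> - (a *: << upd f i u >> + << upd f i v >>))
| symp_rel_perm (f : {ffun 'I_n -> V}) (s : 'S_n) : symp_rel (<< [ffun i => f (s i)] >> - << f >>).

Definition symp : Type := lquot symp_rel.
HB.instance Definition _ := GRing.Lmodule.on symp.

Definition sprod (f : {ffun 'I_n -> V}) : symp := lproj symp_rel << f >>.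
Definition spow (v : V) : symp := sprod [ffun=> v].

Lemma sprod_lin f i a u v :
  sprod (upd f i (a *: u + v)) = a *: sprod (upd f i u) + sprod (upd f i v).
Proof.
rewrite /sprod -lproj_linear.
by apply: lproj_rel2; exact: symp_rel_lin.
Qed.
Lemma sprod_perm (f : {ffun 'I_n -> V}) (s : 'S_n) : sprod [ffun i => f (s i)] = sprod f.
Proof.
by apply: lproj_rel2; exact: symp_rel_perm.
Qed.

Lemma symp_ind (W : symp -> Prop) :
  is_subspace W -> (forall f, W (sprod f)) -> forall t, W t.
Proof.
move=> [W0 Wl] Wt; elim/lquot_ind; apply: malg_ind => [|f]; last exact: Wt.
by split=> [|a p q Wp Wq]; rewrite ?linear0 ?linearP //; apply: Wl.
Qed.

Section Lift.
Variables (M : lmodType K) (b : {ffun 'I_n -> V} -> M).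

Definition symp_lift (t : symp) : M := free_lift b (repr t).

Hypotheses
  (b_lin : forall f i a u v,
     b (upd f i (a *: u + v)) = a *: b (upd f i u) + b (upd f i v))
  (b_perm : forall (f : {ffun 'I_n -> V}) (s : 'S_n), b [ffun i => f (s i)] = b f).

Let lift_rel s : symp_rel s -> free_lift b s = 0.
Proof.
have lf := @free_lift_linear K _ _ b.
by case=> *; rewrite (linear_funB lf) ?lf !free_liftU /= ?b_lin ?b_perm subrr.
Qed.

Lemma symp_liftE f : symp_lift (sprod f) = b f.
Proof.
by rewrite /symp_lift lquot_liftE ?free_liftU //; exact: free_lift_linear.
Qed.
Lemma symp_lift_linear : linear symp_lift.
Proof. by apply: lquot_lift_linear => //; exact: free_lift_linear. Qed.
End Lift.
End SymmetricPower.

(* The commutative unital K-algebra with underlying ring A and structure map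
   iota.  GRing.ComAlgebra would force 1 != 0; here A may be the zero ring. *)
Definition alg_of (K : fieldType) (A : comPzRingType)
  (iota : {rmorphism K -> A}) : Type := A.

Section AlgOf.
Variables (K : fieldType) (A : comPzRingType) (iota : {rmorphism K -> A}).
Local Notation iA := (alg_of iota).

HB.instance Definition _ := GRing.ComPzRing.on iA.

Definition alg_scale (a : K) (x : iA) : iA := iota a * x.

Fact alg_scaleA a b x : alg_scale a (alg_scale b x) = alg_scale (a * b) x.
Proof. by rewrite /alg_scale mulrA -rmorphM. Qed.
Fact alg_scale1 : left_id 1 alg_scale.
Proof. by move=> x; rewrite /alg_scale rmorph1 mul1r. Qed.
Fact alg_scaleDr : right_distributive alg_scale +%R.
Proof. by move=> a x y; rewrite /alg_scale mulrDr. Qed.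
Fact alg_scaleDl x : {morph alg_scale^~ x : a b / a + b}.
Proof. by move=> a b; rewrite /alg_scale rmorphD mulrDl. Qed.
HB.instance Definition _ := GRing.Zmodule_isLmodule.Build K iA
  alg_scaleA alg_scale1 alg_scaleDr alg_scaleDl.

Lemma alg_scaleE (a : K) (x : iA) : a *: x = iota a * x.
Proof. by []. Qed.

Lemma alg_mul_linl (y : iA) : linear (fun x : iA => x * y).
Proof. by move=> a u v; rewrite mulrDl !alg_scaleE mulrA. Qed.
Lemma alg_mul_linr (x : iA) : linear (fun y : iA => x * y).
Proof. by move=> a u v; rewrite mulrC alg_mul_linl ![_ * x]mulrC. Qed.
End AlgOf.

HB.mixin Record Lmodule_isLieAlgebra (K : fieldType) L of GRing.Lmodule K L := {
  lie : L -> L -> L;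
  lie_linl : forall y, linear (lie^~ y);
  lie_linr : forall x, linear (lie x);
  liexx : forall x, lie x x = 0;
  lie_jacobi : forall x y z,
    lie x (lie y z) + lie y (lie z x) + lie z (lie x y) = 0
}.
#[short(type="lieAlgType")]
HB.structure Definition LieAlgebra (K : fieldType) :=
  {L of Lmodule_isLieAlgebra K L & GRing.Lmodule K L}.

Section LieTheory.
Variables (K : fieldType) (L : lieAlgType K).
Lemma lieC (x y : L) : lie x y = - lie y x.
Proof.
apply/eqP; rewrite -subr_eq0 opprK; apply/eqP.
have := liexx (x + y).
rewrite (linear_funD (lie_linr _)) !(linear_funD (lie_linl _)) !liexx.
by rewrite add0r addr0 addrC.
Qed.
End LieTheory.

Section CurrentAlgebra.
Variables (K : fieldType) (g : lieAlgType K) (A0 : comPzRingType)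
  (iota : {rmorphism K -> A0}).
Local Notation A := (alg_of iota).
Implicit Types (x y z : g) (P Q : A) (s t : tensor g A).

Definition cur_lie_pure x P : tensor g A -> tensor g A :=
  tensor_lift (fun y Q => lie x y ⊗t (P * Q)).

Definition cur_lie s t : tensor g A :=
  tensor_lift (fun x P => cur_lie_pure x P t) s.

Lemma cur_lie_pureE x P y Q :
  cur_lie_pure x P (y ⊗t Q) = lie x y ⊗t (P * Q).
Proof.
apply: (tensor_liftE (b := fun y Q => lie x y ⊗t (P * Q))).
  by move=> Q' a u v; rewrite /= lie_linr tens_linl.
by move=> u a Q1 Q2; rewrite /= alg_mul_linr tens_linr.
Qed.

Lemma cur_lie_pure_linear x P : linear (cur_lie_pure x P).
Proof.
apply: (tensor_lift_linear (b := fun y Q => lie x y ⊗t (P * Q))).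
  by move=> Q' a u v; rewrite /= lie_linr tens_linl.
by move=> u a Q1 Q2; rewrite /= alg_mul_linr tens_linr.
Qed.

Lemma linear_fun_eq (U V M : lmodType K) (f h : tensor U V -> M) :
  linear f -> linear h -> (forall u v, f (u ⊗t v) = h (u ⊗t v)) -> f =1 h.
Proof.
move=> lf lh fh; apply: tensor_ind => //; split.
  by rewrite (linear_fun0 lf) (linear_fun0 lh).
by move=> a u v fu fv; rewrite lf lh fu fv.
Qed.

Lemma linear_comb (U V : lmodType K) (f h : U -> V) a :
  linear f -> linear h -> linear (fun u => a *: f u + h u).
Proof.
move=> lf lh b u v; rewrite lf lh !scalerDr !scalerA [a * b]mulrC.
by rewrite -!addrA; congr (_ + _); rewrite addrCA.
Qed.

Lemma cur_lie_pure_linl P t : linear (fun x => cur_lie_pure x P t).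
Proof.
move=> a x1 x2; move: t; apply: linear_fun_eq => [||y Q].
- exact: cur_lie_pure_linear.
- by apply: linear_comb; apply: cur_lie_pure_linear.
- by rewrite !cur_lie_pureE lie_linl tens_linl.
Qed.

Lemma cur_lie_pure_linr x t : linear (fun P => cur_lie_pure x P t).
Proof.
move=> a P1 P2; move: t; apply: linear_fun_eq => [||y Q].
- exact: cur_lie_pure_linear.
- by apply: linear_comb; apply: cur_lie_pure_linear.
- by rewrite !cur_lie_pureE alg_mul_linl tens_linr.
Qed.

Lemma cur_lie_tensl x P t : cur_lie (x ⊗t P) t = cur_lie_pure x P t.
Proof.
apply: (tensor_liftE (b := fun x P => cur_lie_pure x P t)).
  by move=> v; exact: cur_lie_pure_linl.
by move=> u; exact: cur_lie_pure_linr.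
Qed.

Lemma cur_lieE x P y Q :
  cur_lie (x ⊗t P) (y ⊗t Q) = lie x y ⊗t (P * Q).
Proof. by rewrite cur_lie_tensl cur_lie_pureE. Qed.

Fact cur_lie_linl t : linear (cur_lie^~ t).
Proof.
apply: (tensor_lift_linear (b := fun x P => cur_lie_pure x P t)).
  by move=> v; exact: cur_lie_pure_linl.
by move=> u; exact: cur_lie_pure_linr.
Qed.

Fact cur_lie_linr s : linear (cur_lie s).
Proof.
move=> a t1 t2; move: s; apply: linear_fun_eq => [||y Q].
- exact: cur_lie_linl.
- by apply: linear_comb; apply: cur_lie_linl.
- by rewrite !cur_lie_tensl cur_lie_pure_linear.
Qed.

Lemma linear_funN_comp (U V : lmodType K) (f : U -> V) :
  linear f -> linear (fun u => - f u).
Proof. by move=> lf a u v; rewrite lf opprD scalerN. Qed.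

Lemma cur_lieC s t : cur_lie s t = - cur_lie t s.
Proof.
move: s; apply: linear_fun_eq => [||x P].
- exact: cur_lie_linl.
- by apply: linear_funN_comp; apply: cur_lie_linr.
move: t; apply: linear_fun_eq => [||y Q].
- exact: cur_lie_linr.
- by apply: linear_funN_comp; apply: cur_lie_linl.
by rewrite !cur_lieE lieC (linear_funN (tens_linl _)) mulrC.
Qed.

Fact cur_liexx t : cur_lie t t = 0.
Proof.
move: t; apply: tensor_ind => [|x P]; last first.
  by rewrite cur_lieE liexx (linear_fun0 (tens_linl _)).
split=> [|a u v uu vv]; first by rewrite (linear_fun0 (cur_lie_linl _)).
rewrite (cur_lie_linr _ a u v) (cur_lie_linl u a u v) (cur_lie_linl v a u v).
by rewrite uu vv (cur_lieC v u) scaler0 add0r addr0 scalerN addNr.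
Qed.

Lemma linear_add (U V : lmodType K) (f h : U -> V) :
  linear f -> linear h -> linear (fun u => f u + h u).
Proof. by move=> lf lh b u v; rewrite lf lh scalerDr addrACA. Qed.

Lemma linear_compose (U V W : lmodType K) (f : V -> W) (h : U -> V) :
  linear f -> linear h -> linear (fun u => f (h u)).
Proof. by move=> lf lh a u v; rewrite lh lf. Qed.

Lemma linear_zero (U V : lmodType K) : linear (fun _ : U => 0 : V).
Proof. by move=> a u v; rewrite scaler0 addr0. Qed.

Fact cur_lie_jacobi s t u :
  cur_lie s (cur_lie t u) + cur_lie t (cur_lie u s) + cur_lie u (cur_lie s t)
  = 0.
Proof.
have ll := cur_lie_linl; have lr := cur_lie_linr.
move: s; apply: linear_fun_eq => [||x P].
- apply: linear_add; first apply: linear_add.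
  + exact: ll.
  + exact: (linear_compose (lr t) (lr u)).
  + exact: (linear_compose (lr u) (ll t)).
- exact: linear_zero.
move: t; apply: linear_fun_eq => [||y Q].
- apply: linear_add; first apply: linear_add.
  + exact: (linear_compose (lr _) (ll u)).
  + exact: ll.
  + exact: (linear_compose (lr u) (lr _)).
- exact: linear_zero.
move: u; apply: linear_fun_eq => [||z R].
- apply: linear_add; first apply: linear_add.
  + exact: (linear_compose (lr _) (lr _)).
  + exact: (linear_compose (lr _) (ll _)).
  + exact: ll.
- exact: linear_zero.
rewrite !cur_lieE mulrA [Q * (R * P)]mulrA [Q * R]mulrC [R * (P * Q)]mulrA.
rewrite [R * Q * P]mulrC [R * P]mulrC [P * (R * Q)]mulrA [P * Q * R]mulrAC.
by rewrite -!(linear_funD (tens_linl _)) lie_jacobi (linear_fun0 (tens_linl _)).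
Qed.

HB.instance Definition _ := Lmodule_isLieAlgebra.Build K (tensor g A)
  cur_lie_linl cur_lie_linr cur_liexx cur_lie_jacobi.

Lemma lie_tens x P y Q : lie (x ⊗t P) (y ⊗t Q) = lie x y ⊗t (P * Q).
Proof. exact: cur_lieE. Qed.
End CurrentAlgebra.

Record lie_rep (K : fieldType) (L : lieAlgType K) (M : lmodType K) := LieRep {
  lact :> L -> M -> M;
  lact_linl : forall m, linear (lact^~ m);
  lact_linr : forall x, linear (lact x);
  lact_lie : forall x y m,
    lact (lie x y) m = lact x (lact y m) - lact y (lact x m)
}.

Section RestrictOne.
Variables (K : fieldType) (g : lieAlgType K) (A0 : comPzRingType)
  (iota : {rmorphism K -> A0}).
Local Notation A := (alg_of iota).
Variables (M : lmodType K) (rho : lie_rep (tensor g A) M).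

Fact rep1_linl m : linear (fun x : g => rho (x ⊗t (1 : A)) m).
Proof. by move=> a x y; rewrite /= tens_linl lact_linl. Qed.
Fact rep1_lie (x y : g) m : rho (lie x y ⊗t (1 : A)) m =
  rho (x ⊗t (1 : A)) (rho (y ⊗t (1 : A)) m)
  - rho (y ⊗t (1 : A)) (rho (x ⊗t (1 : A)) m).
Proof. by rewrite -lact_lie lie_tens mulr1. Qed.

(* Restriction to g, identified with g ⊗ 1. *)
Definition rep_at1 : lie_rep g M :=
  LieRep rep1_linl (fun x => lact_linr rho (x ⊗t (1 : A))) rep1_lie.
End RestrictOne.

Section TensorRep.
Variables (K : fieldType) (g : lieAlgType K) (A0 : comPzRingType)
  (iota : {rmorphism K -> A0}).
Local Notation A := (alg_of iota).
Variables (V : lmodType K) (rho : lie_rep g V).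

Definition tact_pure (x : g) (P : A) : tensor V A -> tensor V A :=
  tensor_lift (fun w Q => rho x w ⊗t (P * Q)).

Definition tact (s : tensor g A) (m : tensor V A) : tensor V A :=
  tensor_lift (fun x P => tact_pure x P m) s.

Lemma tact_pure_bil (x : g) (P : A) :
  (forall Q, linear (fun w => rho x w ⊗t (P * Q))) *
  (forall w, linear (fun Q => rho x w ⊗t (P * Q))).
Proof.
split=> [Q|w] a u v; first by rewrite lact_linr tens_linl.
by rewrite alg_mul_linr tens_linr.
Qed.

Lemma tact_pureE x P w Q : tact_pure x P (w ⊗t Q) = rho x w ⊗t (P * Q).
Proof.
by have [l r] := tact_pure_bil x P;
   apply: (tensor_liftE (b := fun w Q => rho x w ⊗t (P * Q))).
Qed.
Lemma tact_pure_linear x P : linear (tact_pure x P).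
Proof.
by have [l r] := tact_pure_bil x P;
   apply: (tensor_lift_linear (b := fun w Q => rho x w ⊗t (P * Q))).
Qed.

Lemma tact_bil (m : tensor V A) :
  (forall P, linear (fun x => tact_pure x P m)) *
  (forall x, linear (fun P => tact_pure x P m)).
Proof.
split=> [P|x] a u v; move: m; apply: linear_fun_eq => [||w Q].
- exact: tact_pure_linear.
- by apply: linear_comb; apply: tact_pure_linear.
- by rewrite !tact_pureE lact_linl tens_linl.
- exact: tact_pure_linear.
- by apply: linear_comb; apply: tact_pure_linear.
- by rewrite !tact_pureE alg_mul_linl tens_linr.
Qed.

Lemma tact_tensl x P m : tact (x ⊗t P) m = tact_pure x P m.
Proof.
by have [l r] := tact_bil m;
   apply: (tensor_liftE (b := fun x P => tact_pure x P m)).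
Qed.

Fact tact_linl m : linear (tact^~ m).
Proof.
by have [l r] := tact_bil m;
   apply: (tensor_lift_linear (b := fun x P => tact_pure x P m)).
Qed.

Fact tact_linr s : linear (tact s).
Proof.
move=> a t1 t2; move: s; apply: linear_fun_eq => [||x P].
- exact: tact_linl.
- by apply: linear_comb; apply: tact_linl.
- by rewrite !tact_tensl tact_pure_linear.
Qed.

Lemma tactE x P w Q : tact (x ⊗t P) (w ⊗t Q) = rho x w ⊗t (P * Q).
Proof. by rewrite tact_tensl tact_pureE. Qed.

Fact tact_lie s t m : tact (lie s t) m = tact s (tact t m) - tact t (tact s m).
Proof.
have lieE (u v : tensor g A) : lie u v = cur_lie u v by [].
have ll := tact_linl; have lr := tact_linr.
move: s; apply: linear_fun_eq => [||x P].
- exact: (linear_compose (ll m) (lie_linl t)).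
- apply: linear_add; first exact: ll.
  exact: linear_funN_comp (linear_compose (lr t) (ll m)).
move: t; apply: linear_fun_eq => [||y Q].
- exact: (linear_compose (ll m) (lie_linr _)).
- apply: linear_add; first exact: (linear_compose (lr _) (ll m)).
  exact: linear_funN_comp (ll _).
move: m; apply: linear_fun_eq => [||w R].
- exact: lr.
- apply: linear_add; first exact: (linear_compose (lr _) (lr _)).
  exact: linear_funN_comp (linear_compose (lr _) (lr _)).
rewrite lie_tens !tactE lact_lie mulrA [Q * (P * R)]mulrA [Q * P]mulrC.
by rewrite (linear_funD (tens_linl _)) (linear_funN (tens_linl _)).
Qed.

(* (x ⊗ P) (w ⊗ Q) = x w ⊗ P Q, see tensor_repE. *)
Definition tensor_rep : lie_rep (tensor g A) (tensor V A) :=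
  LieRep tact_linl tact_linr tact_lie.

Lemma tensor_repE x P w Q :
  tensor_rep (x ⊗t P) (w ⊗t Q) = rho x w ⊗t (P * Q).
Proof. exact: tactE. Qed.
End TensorRep.
Arguments tensor_rep {K g A0} iota {V} rho.

Section SymRep.
Variables (K : fieldType) (L : lieAlgType K) (n : nat).
Variables (V : lmodType K) (rho : lie_rep L V).
Implicit Types (f : {ffun 'I_n -> V}).

Definition sact_fun (x : L) f : symp n V :=
  \sum_(i < n) sprod (upd f i (rho x (f i))).
Definition sact (x : L) : symp n V -> symp n V := symp_lift (sact_fun x).

Lemma upd_same f i u v : upd (upd f i u) i v = upd f i v.
Proof. by apply/ffunP => j; rewrite !ffunE; case: eqP. Qed.
Lemma upd_swap f i j u v : i != j -> upd (upd f i u) j v = upd (upd f j v) i u.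
Proof.
move=> ij; apply/ffunP => k; rewrite !ffunE.
by case: eqP => // ->; rewrite eq_sym (negPf ij).
Qed.
Lemma upd_at f i u : upd f i u i = u.
Proof. by rewrite ffunE eqxx. Qed.
Lemma upd_out f i j u : j != i -> upd f i u j = f j.
Proof. by rewrite ffunE => /negPf ->. Qed.

Lemma sact_fun_lin x f i a u v :
  sact_fun x (upd f i (a *: u + v)) =
  a *: sact_fun x (upd f i u) + sact_fun x (upd f i v).
Proof.
rewrite /sact_fun scaler_sumr -big_split /=; apply: eq_bigr => j _.
have [->|ji] := eqVneq j i.
  by rewrite !upd_same !upd_at lact_linr sprod_lin.
by rewrite !upd_out // !(upd_swap _ _ _ (i := i)) 1?eq_sym // sprod_lin.
Qed.

Lemma sact_fun_perm x f (s : 'S_n) :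
  sact_fun x [ffun i => f (s i)] = sact_fun x f.
Proof.
rewrite /sact_fun [RHS](reindex_inj (@perm_inj _ s)) /=; apply: eq_bigr => i _.
rewrite -[RHS](sprod_perm _ s); congr sprod; apply/ffunP => j.
by rewrite !ffunE (inj_eq perm_inj).
Qed.

Lemma sactE x f : sact x (sprod f) = sact_fun x f.
Proof.
by rewrite /sact symp_liftE //; [exact: sact_fun_lin|exact: sact_fun_perm].
Qed.

Fact sact_linr x : linear (sact x).
Proof. by apply: symp_lift_linear; [exact: sact_fun_lin|exact: sact_fun_perm]. Qed.

Lemma symp_linear_eq (M : lmodType K) (p q : symp n V -> M) :
  linear p -> linear q -> (forall f, p (sprod f) = q (sprod f)) -> p =1 q.
Proof.
move=> lp lq pq; apply: symp_ind => //; split.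
  by rewrite (linear_fun0 lp) (linear_fun0 lq).
by move=> a u v pu pv; rewrite lp lq pu pv.
Qed.

Lemma sprod_upd_lin f i : linear (fun v => sprod (upd f i v)).
Proof. by move=> a u v; rewrite sprod_lin. Qed.

Fact sact_linl m : linear (sact^~ m).
Proof.
move=> a x y; move: m; apply: symp_linear_eq => [||f].
- exact: sact_linr.
- by apply: linear_comb; apply: sact_linr.
rewrite !sactE /sact_fun scaler_sumr -big_split /=; apply: eq_bigr => i _.
by rewrite lact_linl sprod_lin.
Qed.

Lemma sact_sactE x y f : sact x (sact y (sprod f)) =
  \sum_(i < n) sprod (upd f i (rho x (rho y (f i)))) +
  \sum_(i < n) \sum_(j < n | j != i)
     sprod (upd (upd f i (rho y (f i))) j (rho x (f j))).
Proof.
rewrite sactE /sact_fun (linear_fun_sum (@sact_linr x)) -big_split /=.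
apply: eq_bigr => i _; rewrite sactE /sact_fun (bigD1 i) //=.
rewrite upd_at upd_same; congr (_ + _).
by apply: eq_bigr => j ji; rewrite upd_out.
Qed.

Fact sact_lie x y m : sact (lie x y) m = sact x (sact y m) - sact y (sact x m).
Proof.
move: m; apply: symp_linear_eq => [||f].
- exact: sact_linr.
- apply: linear_add; first exact: linear_compose (@sact_linr _) (@sact_linr _).
  exact: linear_funN_comp (linear_compose (@sact_linr _) (@sact_linr _)).
rewrite !sact_sactE.
set S1 := (X in _ = _ + X - _); set S2 := (X in _ = _ - (_ + X)).
have -> : S1 = S2.
  rewrite /S1 /S2 (exchange_big_dep predT) //=; apply: eq_bigr => i _.
  rewrite (eq_bigl (fun j => j != i)) => [|j]; last by rewrite eq_sym.
  by apply: eq_bigr => j ji; rewrite upd_swap.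
rewrite opprD addrACA subrr addr0 sactE /sact_fun -sumrB.
apply: eq_bigr => i _; rewrite lact_lie.
by rewrite (linear_funD (sprod_upd_lin _ _)) (linear_funN (sprod_upd_lin _ _)).
Qed.

(* x (w_1 ... w_n) = \sum_i w_1 ... (x w_i) ... w_n, see sym_repE. *)
Definition sym_rep : lie_rep L (symp n V) :=
  LieRep sact_linl sact_linr sact_lie.

Lemma sym_repE x f :
  sym_rep x (sprod f) = \sum_(i < n) sprod (upd f i (rho x (f i))).
Proof. exact: sactE. Qed.
End SymRep.
Arguments sym_rep {K L} n {V} rho.

Section SpecialLinear.
Variables (K : fieldType) (m : nat).

Record sl := SL { sl_mx :> 'M[K]_m; sl_tr : \tr sl_mx == 0 }.
HB.instance Definition _ := [isSub for sl_mx].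
HB.instance Definition _ := [Choice of sl by <:].

Fact sl_submod_closed : submod_closed (fun x : 'M[K]_m => \tr x == 0).
Proof.
split=> [|a x y /eqP x0 /eqP y0]; rewrite unfold_in ?mxtrace0 //.
by rewrite mxtraceD mxtraceZ x0 y0 mulr0 addr0.
Qed.
HB.instance Definition _ :=
  GRing.SubChoice_isSubLmodule.Build K _ _ sl sl_submod_closed.

Fact sl_lie_subproof (x y : sl) : \tr (x *m y - y *m x) == 0.
Proof. by rewrite linearB /= mxtrace_mulC subrr. Qed.
Definition sl_lie (x y : sl) : sl := SL (sl_lie_subproof x y).

Fact sl_lie_linl y : linear (sl_lie^~ y).
Proof.
move=> a u v; apply: val_inj; rewrite /= mulmxDl mulmxDr -scalemxAl -scalemxAr.
by rewrite scalerBr opprD addrACA.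
Qed.
Fact sl_liexx x : sl_lie x x = 0.
Proof. by apply: val_inj; rewrite /= subrr. Qed.
Fact sl_lie_linr x : linear (sl_lie x).
Proof.
move=> a u v; apply: val_inj; rewrite /= mulmxDl mulmxDr -scalemxAl -scalemxAr.
by rewrite scalerBr opprD addrACA.
Qed.
Fact sl_lie_jacobi x y z :
  sl_lie x (sl_lie y z) + sl_lie y (sl_lie z x) + sl_lie z (sl_lie x y) = 0.
Proof.
apply: val_inj; rewrite /= !mulmxBl !mulmxBr !mulmxA !opprB.
set a := x *m y *m z; set b := x *m z *m y; set c := y *m z *m x.
set d := z *m y *m x; set e := y *m x *m z; set f := z *m x *m y.
by apply/matrixP => i j; rewrite !mxE; ring.
Qed.
HB.instance Definition _ := Lmodule_isLieAlgebra.Build K sl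
  sl_lie_linl sl_lie_linr sl_liexx sl_lie_jacobi.

Fact vec_rep_linl (v : 'cV[K]_m) : linear (fun x : sl => x *m v).
Proof. by move=> a x y; rewrite mulmxDl -scalemxAl. Qed.
Fact vec_rep_linr (x : sl) : linear (fun v : 'cV[K]_m => x *m v).
Proof. by move=> a u v; rewrite mulmxDr -scalemxAr. Qed.
Fact vec_rep_lie (x y : sl) (v : 'cV[K]_m) :
  lie x y *m v = x *m (y *m v) - y *m (x *m v).
Proof. by rewrite mulmxBl !mulmxA. Qed.

Definition vec_rep : lie_rep sl 'cV[K]_m :=
  LieRep vec_rep_linl vec_rep_linr vec_rep_lie.
End SpecialLinear.

Section Cartan.
Variables (K : fieldType) (r : nat).
Local Notation slr := (sl K r.+1).

Record cartan := Cartan { cartan_sl :> slr; cartan_diag : is_diag_mx cartan_sl }.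
HB.instance Definition _ := [isSub for cartan_sl].
HB.instance Definition _ := [Choice of cartan by <:].

Fact cartan_submod_closed : submod_closed (fun x : slr => is_diag_mx x).
Proof.
split=> [|a x y /is_diag_mxP xd /is_diag_mxP yd]; apply/is_diag_mxP => i j ij.
  by rewrite mxE.
by rewrite /= !mxE xd // yd // mulr0 addr0.
Qed.
HB.instance Definition _ :=
  GRing.SubChoice_isSubLmodule.Build K _ _ cartan cartan_submod_closed.

Definition coroot_mx (i : 'I_r) : 'M[K]_r.+1 :=
  delta_mx (widen_ord (leqnSn r) i) (widen_ord (leqnSn r) i)
  - delta_mx (lift ord0 i) (lift ord0 i).
Fact coroot_tr i : \tr (coroot_mx i) == 0.
Proof.
rewrite linearB /= /mxtrace.
have tr_delta (k : 'I_r.+1) : \sum_i delta_mx k k i i = 1 :> K.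
  rewrite (bigD1 k) //= mxE eqxx big1 ?addr0 // => j /negPf jk.
  by rewrite mxE jk.
by rewrite !tr_delta subrr.
Qed.
Fact coroot_diag i : is_diag_mx (coroot_mx i).
Proof.
apply/is_diag_mxP => j k jk; rewrite !mxE.
suff dz (l : 'I_r.+1) : (j == l) && (k == l) = false by rewrite !dz subrr.
by apply/negP => /andP[/eqP jl /eqP kl]; move: jk; rewrite jl kl eqxx.
Qed.
(* Numbered from 0: coroot i is the usual h_{i+1}. *)
Definition coroot (i : 'I_r) : cartan := @Cartan (SL (coroot_tr i)) (coroot_diag i).

(* All of h^*; the lattice P is cut out by integral_weight. *)
Definition weight := {scalar cartan}.

Definition integral_weight (mu : weight) : Prop :=
  forall i, exists z : int, mu (coroot i) = z%:~R.

Definition omega1_fun (h : cartan) : K := (h : 'M[K]_r.+1) ord0 ord0.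
Fact omega1_scalar : scalar omega1_fun.
Proof. by move=> a u v; rewrite /omega1_fun /= !mxE. Qed.
HB.instance Definition _ :=
  GRing.isLinear.Build K cartan K _ omega1_fun omega1_scalar.
Definition omega1 : weight := omega1_fun.

Definition weight_muln_fun (mu : weight) (n : nat) (h : cartan) : K := mu h *+ n.
Fact weight_muln_scalar mu n : scalar (weight_muln_fun mu n).
Proof. by move=> a u v; rewrite /weight_muln_fun linearP mulrnDl mulrnAr. Qed.
HB.instance Definition _ mu n := GRing.isLinear.Build K cartan K _
  (weight_muln_fun mu n) (weight_muln_scalar mu n).
Definition weight_muln (mu : weight) (n : nat) : weight := weight_muln_fun mu n.

Lemma omega1_coroot (i : 'I_r) : omega1 (coroot i) = (i == 0 :> nat)%:R.
Proof. by rewrite /omega1 /= /omega1_fun /= !mxE -!val_eqE /= !andbb subr0 eq_sym. Qed.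

(* Membership in n_+, for the Borel subalgebra of upper triangular matrices. *)
Definition in_nplus (x : slr) : Prop :=
  forall i j : 'I_r.+1, (j <= i)%N -> x i j = 0.

Section Integrable.
Variables (V : lmodType K) (rho : lie_rep slr V).

Definition weight_space (mu : weight) (v : V) : Prop :=
  forall h : cartan, rho h v = mu h *: v.

(* V is the direct sum of the V^mu over a finite set D = {mu i | i : I} of
   integral weights. *)
Definition integrable : Prop :=
  exists (I : finType) (mu : I -> weight),
    [/\ forall i, integral_weight (mu i),
        forall i j, mu i =1 mu j -> i = j &
        forall v, exists! c : {ffun I -> V},
          (forall i, weight_space (mu i) (c i)) /\ v = \sum_i c i].
End Integrable.

Section WeylModules.
Variables (A0 : comPzRingType) (iota : {rmorphism K -> A0}).
Local Notation A := (alg_of iota).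
Local Notation gA := (tensor slr A).

Definition generated_by (M : lmodType K) (rho : lie_rep gA M) (w : M) : Prop :=
  forall W : M -> Prop, is_subspace W -> (forall x m, W m -> W (rho x m)) ->
    W w -> forall m, W m.

Definition highest_weight_module (lam : weight) (M : lmodType K)
    (rho : lie_rep gA M) (w : M) : Prop :=
  [/\ integrable (rep_at1 rho),
      generated_by rho w,
      forall (x : slr) (P : A), in_nplus x -> rho (x ⊗t P) w = 0 &
      forall h : cartan, rho ((h : slr) ⊗t (1 : A)) w = lam h *: w].

Definition rep_hom (M N : lmodType K) (rho : lie_rep gA M) (sigma : lie_rep gA N)
    (f : {linear M -> N}) : Prop :=
  forall x m, f (rho x m) = sigma x (f m).

(* Maximality: any other such module is a quotient, generator to generator. *)
Definition global_weyl_module (lam : weight) (M : lmodType K)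
    (rho : lie_rep gA M) (w : M) : Prop :=
  highest_weight_module lam rho w /\
  forall (N : lmodType K) (sigma : lie_rep gA N) (u : N),
    highest_weight_module lam sigma u ->
    exists f : {linear M -> N},
      [/\ rep_hom rho sigma f, f w = u & forall y, exists x, f x = y].
End WeylModules.
End Cartan.
Arguments omega1 {K r}.

(* Main.v *)
From HB Require Import structures.
Require Import Defs.
From mathcomp Require Import all_boot all_order all_algebra.
From mathcomp Require Import ssrAC zify ring perm.
From mathcomp.classical Require Import boolp.
From mathcomp.reals Require Import reals.
From mathcomp.real_closed Require Import complex.
Set Implicit Arguments.
Unset Strict Implicit.
Unset Printing Implicit Defensive.
Import GRing.Theory Num.Theory.
Local Open Scope ring_scope.

(* S^n(V ⊗ A) is itself a global Weyl module, and global Weyl modules are unique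
   up to isomorphism.  That it is a highest weight module is a computation in
   characteristic 0.  For the universal property let N be a module generated by
   a highest weight vector u.  For elements b_i of an associative ring B acting
   as a Lie algebra, put T() = u and
     T(b_0, ..., b_k) =
       b_0 T(b_1, ..., b_k) - \sum_i T(b_1, ..., b_0 b_i, ..., b_k);
   T is symmetric and multilinear.  Take B = M_(r+1)(A), and identify V ⊗ A with
   the matrices supported in column 0.  The matrices vanishing in column 0 form
   a left ideal annihilating u, by integrability and sl_2 theory, so T vanishes
   as soon as one of its entries is in that ideal.  If moreover T vanishes on
   n + 1 arguments then b T(y_1, ..., y_n) = \sum_i T(y_1, ..., b y_i, ..., y_n),
   and y_1 ... y_n |-> T(y_1, ..., y_n) / n! is the required morphism from
   S^n(V ⊗ A) to N.  The vanishing on n + 1 arguments holds for multiples of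
   E_10, where T is a product of n + 1 lowering operators, and spreads to all
   columns by applying matrices supported in column 1. *)

(** * Polarization of a Lie action of an associative ring *)

Section ListDerivation.
Variables (K : fieldType) (F : lmodType K) (Y : Type).
Implicit Types (op : Y -> Y) (G : seq Y -> F) (s : seq Y).

(** The derivation induced by [op], seen through [G]: the sum of the values of [G] on the lists in
    which [op] has been applied to exactly one entry of [s]. *)
Fixpoint lderiv op G s : F :=
  if s is x :: s' then G (op x :: s') + lderiv op (fun t => G (x :: t)) s'
  else 0.

Lemma eq_lderiv op op' G G' s : op =1 op' ->
  (forall t, size t = size s -> G t = G' t) -> lderiv op G s = lderiv op' G' s.
Proof.
move=> eop; elim: s G G' => //= x s IH G G' eG.
by rewrite eop eG // (IH _ (fun t => G' (x :: t))) // => t st; rewrite eG //= st.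
Qed.

Lemma lderiv_cat op G s1 s2 : lderiv op G (s1 ++ s2) =
  lderiv op (fun t => G (t ++ s2)) s1 + lderiv op (fun t => G (s1 ++ t)) s2.
Proof. by elim: s1 G => [|x s1 IH] G /=; rewrite ?add0r // IH addrA. Qed.

Lemma lderivD op G G' s :
  lderiv op (fun t => G t + G' t) s = lderiv op G s + lderiv op G' s.
Proof.
elim: s G G' => [|x s IH] G G' /=; first by rewrite addr0.
by rewrite IH addrACA.
Qed.

Lemma lderivN op G s : lderiv op (fun t => - G t) s = - lderiv op G s.
Proof. by elim: s G => [|x s IH] G /=; rewrite ?oppr0 // IH opprD. Qed.

Lemma lderivB op G G' s :
  lderiv op (fun t => G t - G' t) s = lderiv op G s - lderiv op G' s.
Proof. by rewrite lderivD lderivN. Qed.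

Lemma lderiv_comb a op G G' s :
  lderiv op (fun t => a *: G t + G' t) s = a *: lderiv op G s + lderiv op G' s.
Proof.
elim: s G G' => [|x s IH] G G' /=; first by rewrite scaler0 addr0.
by rewrite IH scalerDr addrACA.
Qed.

Lemma lderiv_const op G s v :
  (forall s1 x s2, s = s1 ++ x :: s2 -> G (s1 ++ op x :: s2) = v) ->
  lderiv op G s = v *+ size s.
Proof.
elim: s G => [|x s IH] G Gv //=; rewrite mulrS; congr (_ + _).
  exact: (Gv [::]).
by apply: IH => s1 y s2 es; apply: (Gv (x :: s1)); rewrite es.
Qed.

Lemma lderiv_eq0 op G s :
  (forall s1 x s2, s = s1 ++ x :: s2 -> G (s1 ++ op x :: s2) = 0) ->
  lderiv op G s = 0.
Proof. by move=> /lderiv_const ->; rewrite mul0rn. Qed.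

Lemma lderiv_lin op op1 op2 (a : K) G s :
  (forall s1 x s2, s = s1 ++ x :: s2 -> G (s1 ++ op x :: s2) =
     a *: G (s1 ++ op1 x :: s2) + G (s1 ++ op2 x :: s2)) ->
  lderiv op G s = a *: lderiv op1 G s + lderiv op2 G s.
Proof.
elim: s G => [|x s IH] G Gl /=; first by rewrite scaler0 addr0.
rewrite (Gl [::]) // IH => [|s1 y s2 es]; last by apply: (Gl (x :: s1)); rewrite es.
by rewrite scalerDr addrACA.
Qed.

(** When the two derivations are iterated, pairs of distinct positions contribute symmetrically. A
    repeated position contributes the composite in one order, and the added term supplies the other
    order. *)
Lemma lderiv_comm op1 op2 G s :
  lderiv op1 (lderiv op2 G) s + lderiv (op1 \o op2) G s =
  lderiv op2 (lderiv op1 G) s + lderiv (op2 \o op1) G s.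
Proof.
elim: s G => [|x s IH] G //=.
rewrite !lderivD [LHS](AC (2*2*2) ((1*5*2*3)*(4*6))).
rewrite [RHS](AC (2*2*2) ((5*1*3*2)*(4*6))) /=.
by congr (_ + _); apply: IH.
Qed.
End ListDerivation.

Lemma lderiv_map (K : fieldType) (F : lmodType K) (Y Z : Type) (h : Z -> Y)
    (op : Y -> Y) (op' : Z -> Z) (G : seq Y -> F) s :
  (forall z, op (h z) = h (op' z)) ->
  lderiv op G (map h s) = lderiv op' (fun t => G (map h t)) s.
Proof. by move=> oph; elim: s G => //= x s IH G; rewrite oph IH. Qed.

(** Distinct indices name the positions, which turns the recursive sum into the indexed sum that
    occurs in the action on a symmetric power. *)
Lemma lderiv_uniq (K : fieldType) (F : lmodType K) (Y : Type) (I : eqType)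
    (f : I -> Y) (op : Y -> Y) (G : seq Y -> F) (s : seq I) : uniq s ->
  lderiv op G (map f s) =
  \sum_(i <- s) G [seq if j == i then op (f j) else f j | j <- s].
Proof.
elim: s G => [|x s IH] G /=; first by rewrite big_nil.
case/andP=> xs us; rewrite big_cons eqxx IH //; congr (_ + _).
  congr G; congr (_ :: _); apply/eq_in_map => j js.
  by case: eqP => // jx; rewrite -jx js in xs.
apply: eq_big_seq => i iS; congr G; congr (_ :: _).
by case: eqP => // xi; rewrite xi iS in xs.
Qed.

Lemma lderiv_comp_linear (K : fieldType) (F F' : lmodType K) (Y : Type)
    (h : F -> F') (op : Y -> Y) (G : seq Y -> F) s : linear h ->
  lderiv op (fun t => h (G t)) s = h (lderiv op G s).
Proof.
move=> lh; elim: s G => [|x s IH] G /=; first by rewrite (linear_fun0 lh).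
by rewrite IH (linear_funD lh).
Qed.

Section Polarization.
Variables (K : fieldType) (B : pzRingType) (j : K -> B) (F : lmodType K).
Variables (act : B -> F -> F) (phi0 : F).
Hypotheses (jC : forall a b, j a * b = b * j a)
  (act_linl : forall a b c phi,
     act (j a * b + c) phi = a *: act b phi + act c phi)
  (act_linr : forall b, linear (act b))
  (act_lie : forall b c phi,
     act b (act c phi) - act c (act b phi) = act (b * c) phi - act (c * b) phi).

(* When F is the n-th tensor power of B, each b acting as the sum of its left
   multiplications on the n factors, and phi0 = 1, this is the sum, over all
   injections of the positions of s into the n factors, of the corresponding
   pure tensors. *)
Fixpoint polar_rec k (s : seq B) : F :=
  if (k, s) is (k'.+1, b :: s') then
    act b (polar_rec k' s') - lderiv ( *%R b) (polar_rec k') s'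
  else phi0.
(** The counter of [polar_rec] is the length: recursive calls are made on modified tails, which are
    not subterms but keep their length. *)
Definition polar s := polar_rec (size s) s.

Lemma polar_cons b s :
  polar (b :: s) = act b (polar s) - lderiv ( *%R b) polar s.
Proof.
rewrite {1}/polar /=; congr (_ - _).
by apply: eq_lderiv => // t st; rewrite /polar st.
Qed.

Lemma act_polar b s : act b (polar s) = polar (b :: s) + lderiv ( *%R b) polar s.
Proof. by rewrite polar_cons subrK. Qed.

(** Expanding both entries leaves three groups: the double action minus the action of the product,
    symmetric by [act_lie]; the mixed terms, visibly symmetric; and the derivation terms, symmetric
    by [lderiv_comm]. *)
Lemma polar_swap2 b c s : polar [:: b, c & s] = polar [:: c, b & s].
Proof.
have H b' c' : polar [:: b', c' & s] =
   (act b' (act c' (polar s)) - act (b' * c') (polar s))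
   - (act b' (lderiv ( *%R c') polar s) + act c' (lderiv ( *%R b') polar s))
   + (lderiv ( *%R (b' * c')) polar s + lderiv ( *%R b') (lderiv ( *%R c') polar) s).
  rewrite !polar_cons (linear_funB (act_linr _)) /= polar_cons.
  rewrite (@eq_lderiv _ _ _ _ ( *%R b') (fun t => polar (c' :: t))
    (fun t => act c' (polar t) - lderiv ( *%R c') polar t)) // => [|t _];
    last by rewrite polar_cons.
  rewrite lderivB lderiv_comp_linear //.
  by rewrite !opprD !opprK !addrA [LHS](AC 6 (1*3*2*5*4*6)).
rewrite !H; congr (_ - _ + _).
- have /eqP := act_lie b c (polar s); rewrite subr_eq => /eqP ->.
  by rewrite addrAC [_ - _ - _]addrAC subrr sub0r addrC.
- by rewrite addrC.
have M b' c' : lderiv ( *%R (b' * c')) polar s = lderiv ( *%R b' \o *%R c') polar s.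
  by apply: eq_lderiv => // x /=; rewrite mulrA.
by rewrite !M addrC lderiv_comm addrC.
Qed.

Lemma polar_swap s1 b c s2 :
  polar (s1 ++ [:: b, c & s2]) = polar (s1 ++ [:: c, b & s2]).
Proof.
have [k] := ubnP (size (s1 ++ s2)).
elim: k s1 b c s2 => // k IH [|d s1] b c s2 /=; first by rewrite polar_swap2.
rewrite ltnS => lek; rewrite !polar_cons !lderiv_cat /=; congr (act _ _ - _).
  exact: IH.
congr (_ + _).
  apply: eq_lderiv => // t st; apply: IH.
  by rewrite size_cat st -size_cat.
(* The terms in which [d] hits [b] and [c] come in opposite orders on the two sides. *)
rewrite [RHS]addrCA; congr (_ + (_ + _)).
- exact: IH.
- exact: IH.
apply: eq_lderiv => // t st; apply: IH.
by rewrite size_cat st -size_cat.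
Qed.

Lemma polar_perm s t : perm_eq s t -> polar s = polar t.
Proof.
have front s1 b s2 s3 : polar (s3 ++ s1 ++ b :: s2) = polar (s3 ++ b :: s1 ++ s2).
  elim: s1 s3 => // c s1 IH s3.
  have := IH (rcons s3 c); rewrite !cat_rcons => ->.
  by rewrite polar_swap.
suff H s3 : perm_eq s t -> polar (s3 ++ s) = polar (s3 ++ t) by exact: (H [::]).
elim: s t s3 => [|b s IH] t s3 st.
  by move: st; rewrite perm_sym => /perm_nilP ->.
have bt : b \in t by rewrite -(perm_mem st) mem_head.

case/splitPr: bt st => t1 t2 st.
rewrite front -!cat_rcons; apply: IH.
by rewrite -(perm_cons b) (permPl st) perm_catC /= perm_cons perm_catC.
Qed.

(** Induction on the length. Centrality of [j a] enters when an earlier entry [d] multiplies the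
    combination. *)
Lemma polar_lin s1 a b c s2 : polar (s1 ++ (j a * b + c) :: s2) =
  a *: polar (s1 ++ b :: s2) + polar (s1 ++ c :: s2).
Proof.
have [k] := ubnP (size (s1 ++ s2)).
elim: k s1 b c s2 => // k IH [|d s1] b c s2 /=.
  rewrite ltnS => lek; rewrite !polar_cons act_linl.
  rewrite (@lderiv_lin _ _ _ _ ( *%R b) ( *%R c) a) => [|t1 x t2 es].
    by rewrite scalerBr opprD addrACA.
  rewrite mulrDl -mulrA; apply: IH; move: lek.
  by rewrite es !size_cat /= addnS.
rewrite ltnS => lek; rewrite !polar_cons !lderiv_cat /= IH // act_linr.
have -> : lderiv ( *%R d) (fun t => polar (t ++ (j a * b + c) :: s2)) s1 =
    a *: lderiv ( *%R d) (fun t => polar (t ++ b :: s2)) s1 +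
    lderiv ( *%R d) (fun t => polar (t ++ c :: s2)) s1.
  rewrite -lderiv_comb; apply: eq_lderiv => // t st; apply: IH.
  by rewrite size_cat st -size_cat.
have -> : lderiv ( *%R d) (fun t => polar (s1 ++ (j a * b + c) :: t)) s2 =
    a *: lderiv ( *%R d) (fun t => polar (s1 ++ b :: t)) s2 +
    lderiv ( *%R d) (fun t => polar (s1 ++ c :: t)) s2.
  rewrite -lderiv_comb; apply: eq_lderiv => // t st; apply: IH.
  by rewrite size_cat st -size_cat.
have -> : d * (j a * b + c) = j a * (d * b) + d * c.
  by rewrite mulrDr !mulrA -(jC a d).
have E u v u' v' : a *: u + v + (a *: u' + v') = a *: (u + u') + (v + v') :> F.
  by rewrite scalerDr addrACA.
by rewrite IH // !E scalerBr opprD addrACA.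
Qed.

Lemma polar0 s1 s2 : polar (s1 ++ 0 :: s2) = 0.
Proof.
have := polar_lin s1 (-1) 0 0 s2; rewrite mulr0 addr0 scaleN1r.
by move/eqP; rewrite eq_sym addNr => /eqP <-.
Qed.

(** By symmetry the entry from [L] may stand last, where it is applied to [phi0] directly. An entry
    in front of it can only multiply it on the left, which keeps it in [L], or change other
    entries. *)
Lemma polar_ideal (L : B -> Prop) s x :
  (forall b y, L y -> L (b * y)) -> (forall y, L y -> act y phi0 = 0) ->
  L x -> polar (x :: s) = 0.
Proof.
move=> Lmul L0 Lx.
rewrite (@polar_perm (x :: s) (rcons s x)); last by rewrite -perm_rcons.
rewrite -cats1; have [k] := ubnP (size s).
elim: k s x Lx => // k IH [|b s] x Lx lek.
  by rewrite /= polar_cons subr0 L0.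
rewrite /= polar_cons IH // (linear_fun0 (act_linr _)) lderiv_cat /= addr0.
rewrite IH //; last exact: Lmul.
rewrite lderiv_eq0 ?addr0 ?subr0 // => s1 y s2 es.
by apply: IH => //; move: lek; rewrite /= es !size_cat.
Qed.

(** Since [e] is idempotent, each of the [k] derivation terms gives back the same value, so one more
    [e] multiplies by [n - k]. *)
Lemma polar_eigen e (n : nat) k : e * e = e -> act e phi0 = n%:R *: phi0 ->
  polar (nseq k e) = (n ^_ k)%:R *: phi0.
Proof.
move=> ee en; elim: k => [|k IH]; first by rewrite ffactn0 scale1r.
have -> : nseq k.+1 e = e :: nseq k e by [].
rewrite polar_cons (@lderiv_const _ _ _ _ _ _ (polar (nseq k e))); last first.
  move=> s1 x s2 es; have -> : e * x = x; last by rewrite -es.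
  have : x \in nseq k e by rewrite es mem_cat mem_head orbT.
  by move/nseqP=> [-> _].
rewrite size_nseq IH (linear_funZ (act_linr _)) en scalerA -scaler_nat scalerA.
rewrite -scalerBl; congr (_ *: _); rewrite -!natrM.
(* For [k > n] the factor [n - k] is negative in [K], but the falling factorials on both sides are
   already zero. *)
have [lekn|ltnk] := leqP k n.
  by rewrite [(_ * n)%N]mulnC -natrB ?leq_mul2r ?lekn ?orbT // -mulnBl mulnC ffactnSr.
by rewrite !ffact_small ?muln0 ?mul0n ?subrr // ltnW.
Qed.
End Polarization.

Lemma mulrn_lmod_eq0 (K : numFieldType) (V : lmodType K) (v : V) k :
  v *+ k.+1 = 0 -> v = 0.
Proof.
rewrite -scaler_nat => /(congr1 ( *:%R k.+1%:R^-1)).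
by rewrite scalerA mulVf ?pnatr_eq0 // scale1r scaler0.
Qed.

Lemma map_eq_cat_cons (T U : Type) (f : T -> U) s s1 y s2 :
  map f s = s1 ++ y :: s2 ->
  exists t1 x t2, [/\ s = t1 ++ x :: t2, s1 = map f t1, y = f x & s2 = map f t2].
Proof.
elim: s1 s => [|z s1 IH] [|x s] //= [<- es]; first by exists [::], x, s.
by have [t1 [x' [t2 [-> -> -> ->]]]] := IH s es; exists (x :: t1), x', t2.
Qed.

(** * Polarization on matrices supported in column 0 *)

Section ColumnPolarization.
Variables (K : numFieldType) (A : comPzRingType) (iota : {rmorphism K -> A}).
Variables (r : nat) (F : lmodType K) (act : 'M[A]_r.+1 -> F -> F) (phi0 : F).
Hypotheses
  (act_linl : forall a b c phi,
     act ((iota a)%:M * b + c) phi = a *: act b phi + act c phi)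
  (act_linr : forall b, linear (act b))
  (act_lie : forall b c phi,
     act b (act c phi) - act c (act b phi) = act (b * c) phi - act (c * b) phi)
  (act_phi0 : forall b : 'M_r.+1, (forall i, b i ord0 = 0) -> act b phi0 = 0).

Let jC (a : K) (b : 'M[A]_r.+1) : (iota a)%:M * b = b * (iota a)%:M.
Proof. exact: (esym (scalar_mxC (iota a) b)). Qed.

(** [delta_mx] is a row vector here, so the product has [y] as column 0 and zeros elsewhere. *)
Definition col0_mx (y : 'cV[A]_r.+1) : 'M[A]_r.+1 := y *m delta_mx ord0 ord0.

Definition cpolar (s : seq 'cV[A]_r.+1) : F := polar act phi0 (map col0_mx s).

Lemma mul_col0_mx b y : b * col0_mx y = col0_mx (b *m y).
Proof. by rewrite /col0_mx -mulmxA. Qed.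

Lemma cpolar_perm s t : perm_eq s t -> cpolar s = cpolar t.
Proof.
by move=> st; apply: (polar_perm phi0 act_linr act_lie); apply: perm_map.
Qed.

Lemma cpolar_lin s1 a u v s2 : cpolar (s1 ++ (iota a *: u + v) :: s2) =
  a *: cpolar (s1 ++ u :: s2) + cpolar (s1 ++ v :: s2).
Proof.
rewrite /cpolar !map_cat /= -(polar_lin _ jC act_linl act_linr).
by rewrite /col0_mx mulmxDl -scalemxAl [_%:M * _]mul_scalar_mx.
Qed.

(** Such a [b] lies in the left ideal annihilating [phi0], so the polarization with [b] prepended
    vanishes and only the derivation remains. *)
Lemma act_cpolar (b : 'M_r.+1) s : (forall i, b i ord0 = 0) ->
  act b (cpolar s) = lderiv (mulmx b) cpolar s.
Proof.
move=> b0; rewrite /cpolar act_polar.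
rewrite (lderiv_map (op' := mulmx b)) => [|y]; last exact: mul_col0_mx.
rewrite (polar_ideal act_linr act_lie (L := fun y => forall i, y i ord0 = 0)) //.
  by rewrite add0r.
by move=> c y y0 i; rewrite mxE big1 // => k _; rewrite y0 mulr0.
Qed.

Section Vanishing.
Variables (i1 : 'I_r.+1) (n : nat).
Hypotheses (i1_neq0 : i1 != ord0)
  (act_lower : forall ps : seq A, size ps = n.+1 ->
     foldr act phi0 [seq P *: delta_mx i1 ord0 | P <- ps] = 0).

Let e1 (P : A) : 'cV[A]_r.+1 := P *: delta_mx i1 ord0.

(** Products of two multiples of [delta_mx i1 ord0] vanish because [i1 != ord0]. All derivation
    terms are therefore zero, and the polarization is the plain composite of the actions. *)
Lemma cpolar_lower ps : size ps = n.+1 -> cpolar (map e1 ps) = 0.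
Proof.
move=> sps; rewrite -(act_lower sps) /cpolar -map_comp; elim: ps {sps} => //= P ps IH.
rewrite polar_cons IH lderiv_eq0 ?subr0.
  congr (act _ _).
  by rewrite /col0_mx /e1 -scalemxAl mul_delta_mx.
move=> s1 x s2 es; have /mapP[Q _ ->] : x \in map (col0_mx \o e1) ps.
  by rewrite es mem_cat mem_head orbT.
rewrite /= mul_col0_mx /col0_mx /e1 -scalemxAl mul_delta_mx -scalemxAl -scalemxAr.
rewrite mul_delta_mx_0 1?eq_sym // !scaler0 mul0mx.
exact: (polar0 _ jC act_linl act_linr).
Qed.

(** Splitting the coefficients into [ps] and [l] ones allows induction on the length of [ps]. A
    matrix [x] sending every [e1 P] to [P *: w] acts on a list with [l + 1] ones, whose value is
    zero. Hits in [ws] give zero by hypothesis, hits in [ps] give zero by induction with [P *: w] in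
    place of [w], and hits in the ones give [l + 1] copies of the goal. *)
Lemma cpolar_vanish_step m :
  (forall ws ps, size ws = m -> (m + size ps = n.+1)%N ->
     cpolar (ws ++ map e1 ps) = 0) ->
  forall ps l w ws, size ws = m -> (m + (size ps + l) = n)%N ->
    cpolar (w :: ws ++ map e1 (ps ++ nseq l 1)) = 0.
Proof.
move=> IHm ps; have [k] := ubnP (size ps).
elim: k ps => // k IH ps lek l w ws sws sps.
have [x x0 xe1] : exists2 x : 'M[A]_r.+1, (forall i, x i ord0 = 0) &
    forall P, x *m e1 P = P *: w.
  (* This matrix is supported in column [i1], away from column 0, so [act_cpolar] applies to it. *)
  exists (w *m delta_mx ord0 i1) => [i|P].
    by rewrite mxE big_ord1 !mxE (eq_sym ord0) (negPf i1_neq0) andbF mulr0.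
  rewrite /e1 -scalemxAr -mulmxA mul_delta_mx.
  congr (_ *: _); rewrite -[RHS]mulmx1; congr (_ *m _).
  by apply/matrixP => i j; rewrite !mxE !ord1.
have := act_cpolar (ws ++ map e1 (ps ++ nseq l.+1 1)) x0.
rewrite IHm //; last by rewrite size_cat size_nseq addnS addnS sps.
rewrite (linear_fun0 (act_linr _)) map_cat !lderiv_cat lderiv_eq0; last first.
  move=> s1 y s2 es; rewrite -map_cat; apply: IHm; first by rewrite -sws es !size_cat.
  by rewrite size_cat size_nseq !addnS sps.
rewrite add0r lderiv_eq0; last first.
  move=> s1 y s2 es; have [p1 [P [p2 [ep -> -> ->]]]] := map_eq_cat_cons es.
  rewrite xe1.
  rewrite -(IH (p1 ++ p2) _ l.+1 (P *: w) ws sws); first last.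
  - by move: sps; rewrite ep !size_cat /=; lia.
  - by move: lek; rewrite ep !size_cat /=; lia.
  apply: cpolar_perm.
  by apply/seq.permP => q; rewrite /= !map_cat !count_cat /= ?count_cat; lia.
rewrite add0r (@lderiv_const _ _ _ _ _ _
  (cpolar (w :: ws ++ map e1 (ps ++ nseq l 1)))).
  by rewrite size_map size_nseq => /esym vk; exact: (mulrn_lmod_eq0 vk).
rewrite map_nseq => s1 y s2 es; apply: cpolar_perm; apply/seq.permP => q.
have -> : x *m y = w.
  have : y \in nseq l.+1 (e1 1) by rewrite es mem_cat mem_head orbT.
  by move=> /nseqP[-> _]; rewrite xe1 scale1r.
have ye : y = e1 1.
  have : y \in nseq l.+1 (e1 1) by rewrite es mem_cat mem_head orbT.
  by move=> /nseqP[->].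
have := congr1 (count q) es.
rewrite ye /= !map_cat map_nseq !count_cat /= !count_nseq.
by case: (q (e1 1)) => /=; lia.
Qed.

(** The number [m] of arbitrary arguments grows from 0, where [cpolar_lower] applies, to [n + 1]. *)
Lemma cpolar_vanish s : size s = n.+1 -> cpolar s = 0.
Proof.
suff H m : forall ws ps, size ws = m -> (m + size ps = n.+1)%N ->
    cpolar (ws ++ map e1 ps) = 0.
  by move=> ss; rewrite -(H _ s [::] ss) ?cats0 // addn0.
elim: m => [|m IH] [|w ws] ps //= => [_|[sws]] sps; first exact: cpolar_lower.
rewrite -[ps]cats0; apply: (cpolar_vanish_step IH (l := 0)) => //.
by rewrite addn0; case: sps.
Qed.

(** Write [b] as [b * e + b * (1 - e)]. Prepending the first summand gives [n + 1] arguments in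
    column 0, where the polarization vanishes; the second lies in the annihilating left ideal. *)
Lemma act_cpolar_size b s : size s = n ->
  act b (cpolar s) = lderiv (mulmx b) cpolar s.
Proof.
move=> ss; pose e : 'M[A]_r.+1 := delta_mx ord0 ord0.
rewrite /cpolar act_polar (lderiv_map (op' := mulmx b)) => [|y];
  last exact: mul_col0_mx.
suff -> : polar act phi0 (b :: map col0_mx s) = 0 by rewrite add0r.
have -> : b = (iota 1)%:M * (b * e) + b * (1 - e).
  by rewrite rmorph1 mul1r mulrBr mulr1 addrC subrK.
rewrite (polar_lin _ jC act_linl act_linr [::]) scale1r /=.
rewrite [X in _ + X](polar_ideal act_linr act_lie
  (L := fun y => forall i, y i ord0 = 0)) //.
- have -> : b * e = col0_mx (b *m delta_mx ord0 ord0).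
    by rewrite /col0_mx -mulmxA mul_delta_mx.
  by rewrite addr0; apply: (@cpolar_vanish (_ :: s)); rewrite /= ss.
- by move=> c y y0 i; rewrite mxE big1 // => k _; rewrite y0 mulr0.
move=> i; rewrite mxE big1 // => k _; rewrite !mxE andbT.
by rewrite subrr mulr0.
Qed.
End Vanishing.
End ColumnPolarization.

(** * Current algebras and matrices over A *)

Section LinearMaps.
Variables (K : fieldType) (U N : lmodType K).

(** With the highest weight vectors as source and [N] as target, these maps form the space on which
    the polarization takes place. *)
Record lmap := LMap { lmap_fun :> U -> N; lmap_linear : linear lmap_fun }.
HB.instance Definition _ := gen_eqMixin lmap.
HB.instance Definition _ := gen_choiceMixin lmap.

Lemma lmapP (f g : lmap) : f =1 g -> f = g.
Proof.
case: f g => [f lf] [g lg] /= /funext fg; case: _ / fg lg => lg.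
by congr LMap; apply: Prop_irrelevance.
Qed.

Definition lmap0 : lmap := LMap (@linear_zero K U N).
Definition lmap_opp (f : lmap) : lmap := LMap (linear_funN_comp (lmap_linear f)).
Definition lmap_add (f g : lmap) : lmap :=
  LMap (linear_add (lmap_linear f) (lmap_linear g)).

Fact lmap_addA : associative lmap_add.
Proof. by move=> f g h; apply: lmapP => u /=; rewrite addrA. Qed.
Fact lmap_addC : commutative lmap_add.
Proof. by move=> f g; apply: lmapP => u /=; rewrite addrC. Qed.
Fact lmap_add0 : left_id lmap0 lmap_add.
Proof. by move=> f; apply: lmapP => u /=; rewrite add0r. Qed.
Fact lmap_addN : left_inverse lmap0 lmap_opp lmap_add.
Proof. by move=> f; apply: lmapP => u /=; rewrite addNr. Qed.
HB.instance Definition _ :=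
  GRing.isZmodule.Build lmap lmap_addA lmap_addC lmap_add0 lmap_addN.

Fact lmap_scale_subproof a (f : lmap) : linear (fun u => a *: f u).
Proof.
by move=> b u v; rewrite lmap_linear scalerDr !scalerA [a * b]mulrC.
Qed.
Definition lmap_scale a (f : lmap) : lmap := LMap (lmap_scale_subproof a f).

Fact lmap_scaleA a b f : lmap_scale a (lmap_scale b f) = lmap_scale (a * b) f.
Proof. by apply: lmapP => u /=; rewrite scalerA. Qed.
Fact lmap_scale1 : left_id 1 lmap_scale.
Proof. by move=> f; apply: lmapP => u /=; rewrite scale1r. Qed.
Fact lmap_scaleDr : right_distributive lmap_scale +%R.
Proof. by move=> a f g; apply: lmapP => u /=; rewrite scalerDr. Qed.
Fact lmap_scaleDl f : {morph lmap_scale^~ f : a b / a + b}.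
Proof. by move=> a b; apply: lmapP => u /=; rewrite scalerDl. Qed.
HB.instance Definition _ := GRing.Zmodule_isLmodule.Build K lmap
  lmap_scaleA lmap_scale1 lmap_scaleDr lmap_scaleDl.

Lemma lmapDE (f g : lmap) u : (f + g) u = f u + g u. Proof. by []. Qed.
Lemma lmapNE (f : lmap) u : (- f) u = - f u. Proof. by []. Qed.
Lemma lmapZE a (f : lmap) u : (a *: f) u = a *: f u. Proof. by []. Qed.
Lemma lmap0E u : (0 : lmap) u = 0. Proof. by []. Qed.
End LinearMaps.

Section CurrentRepresentation.
Variables (K : fieldType) (g : lieAlgType K) (A0 : comPzRingType)
  (iota : {rmorphism K -> A0}) (N : lmodType K).
Local Notation A := (alg_of iota).

(* A representation of g ⊗ A given by the operators of its pure tensors. *)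
Record cur_rep := CurRep {
  cact :> g -> A -> N -> N;
  cact_linx : forall P v, linear (fun x => cact x P v);
  cact_linP : forall x v, linear (fun P => cact x P v);
  cact_lin : forall x P, linear (cact x P);
  cact_comm : forall x P y Q v,
    cact x P (cact y Q v) = cact y Q (cact x P v) + cact (lie x y) (P * Q) v
}.

Variable rho : lie_rep (tensor g A) N.

Fact cact_linx_subproof P v : linear (fun x => rho (x ⊗t P) v).
Proof. by move=> a x y; rewrite tens_linl lact_linl. Qed.
Fact cact_linP_subproof x v : linear (fun P => rho (x ⊗t P) v).
Proof. by move=> a P Q; rewrite tens_linr lact_linl. Qed.
Fact cact_comm_subproof x P y Q v : rho (x ⊗t P) (rho (y ⊗t Q) v) =
  rho (y ⊗t Q) (rho (x ⊗t P) v) + rho (lie x y ⊗t (P * Q)) v.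
Proof. by rewrite -lie_tens lact_lie addrC subrK. Qed.

Definition cur_rep_of : cur_rep := CurRep cact_linx_subproof
  cact_linP_subproof (fun x P => lact_linr rho (x ⊗t P)) cact_comm_subproof.
End CurrentRepresentation.

(** * Traceless matrix units and the action of matrices over A *)

Section CurrentSl.
Variables (K : numFieldType) (A0 : comPzRingType) (iota : {rmorphism K -> A0}).
Variable r : nat.
Local Notation A := (alg_of iota).
Local Notation slr := (sl K r.+1).

(** The traceless part of a matrix unit. It is defined for every pair of indices, so sums over all
    entries need no separate treatment of the diagonal. *)
Definition sl_unit_mx (i j : 'I_r.+1) : 'M[K]_r.+1 :=
  delta_mx i j - ((i == j)%:R / r.+1%:R)%:M.
Fact sl_unit_tr i j : \tr (sl_unit_mx i j) == 0.
Proof.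
rewrite linearB /= mxtrace_scalar -[_ *+ _]mulr_natr divfK ?pnatr_eq0 //.
rewrite /mxtrace (bigD1 i) //= mxE eqxx /= big1 ?addr0 => [|k /negPf ki].
  by rewrite subrr.
by rewrite mxE ki.
Qed.
Definition sl_unit i j : slr := SL (sl_unit_tr i j).

(** Scalar matrices drop out of the commutator, and the scalar corrections on the right cancel,
    leaving the relations of the matrix units. *)
Lemma lie_sl_unit i j k l : lie (sl_unit i j) (sl_unit k l) =
  (j == k)%:R *: sl_unit i l - (l == i)%:R *: sl_unit k j.
Proof.
have C (E F : 'M[K]_r.+1) c d :
    (E - c%:M) *m (F - d%:M) - (F - d%:M) *m (E - c%:M) = E *m F - F *m E.
  rewrite !mulmxBl !mulmxBr !mul_scalar_mx !mul_mx_scalar !opprD !opprK.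
  rewrite [c *: d%:M]scale_scalar_mx [d *: c%:M]scale_scalar_mx [d * c]mulrC.
  rewrite !addrA [LHS](AC 8 ((1*5)*((2*7)*(3*6)*(4*8)))) /=.
  by rewrite !addNr !subrr !addr0.
apply: val_inj => /=; rewrite /sl_unit_mx C !mul_delta_mx_cond.
rewrite !scalerBr !scaler_nat.
have -> : ((i == l)%:R / r.+1%:R : K)%:M *+ (j == k) =
    ((k == j)%:R / r.+1%:R : K)%:M *+ (l == i) :> 'M_r.+1.
  rewrite (eq_sym i) (eq_sym j); case: (l == i); case: (k == j) => //=;
  by rewrite mul0r; apply/matrixP => s t; rewrite !mxE mul0rn.
by rewrite opprB addrA subrK.
Qed.

(** The scalar corrections add up to the trace of [x] divided by [r + 1], which is zero. *)
Lemma sum_sl_unit (x : slr) : \sum_p x p.1 p.2 *: sl_unit p.1 p.2 = x.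
Proof.
apply: val_inj; rewrite linear_sum /=.
transitivity (\sum_i \sum_j x i j *: sl_unit_mx i j).
  by rewrite [RHS]pair_bigA.
under eq_bigr => i _ do (under eq_bigr => j _ do rewrite scalerBr; rewrite sumrB).
rewrite sumrB -matrix_sum_delta.
rewrite [X in _ - X](_ : _ = (\sum_i (x i i / r.+1%:R))%:M).
  rewrite -mulr_suml; have /eqP := sl_tr x; rewrite /mxtrace => ->.
  by rewrite mul0r raddf0 subr0.
rewrite raddf_sum; apply: eq_bigr => i _.
rewrite (bigD1 i) //= eqxx big1 ?addr0 => [|j /negPf ji].
  by rewrite scale_scalar_mx mul1r.
by rewrite eq_sym ji mul0r raddf0 scaler0.
Qed.

Variables (N : lmodType K) (rho : cur_rep slr iota N).

(* Since sl_unit i j is the traceless part of a matrix unit, this is the action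
   of the traceless part of X. *)
Definition mx_cact (X : 'M[A]_r.+1) (v : N) : N :=
  \sum_(p : 'I_r.+1 * 'I_r.+1) rho (sl_unit p.1 p.2) (X p.1 p.2) v.

Lemma mx_cact_linl a X Y v :
  mx_cact ((iota a : A)%:M * X + Y) v = a *: mx_cact X v + mx_cact Y v.
Proof.
rewrite /mx_cact scaler_sumr -big_split /=; apply: eq_bigr => p _.
by rewrite [_%:M * X]mul_scalar_mx !mxE -(cact_linP rho).
Qed.

Lemma mx_cact_linr X : linear (mx_cact X).
Proof.
move=> a u v; rewrite /mx_cact scaler_sumr -big_split /=.
by apply: eq_bigr => p _; rewrite cact_lin.
Qed.

Lemma mx_cactM X Y v : mx_cact (X * Y) v = \sum_p \sum_(q : 'I_r.+1 * 'I_r.+1)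
  rho ((p.2 == q.1)%:R *: sl_unit p.1 q.2) (X p.1 p.2 * Y q.1 q.2) v.
Proof.
transitivity (\sum_i \sum_j \sum_(q : 'I_r.+1 * 'I_r.+1)
    rho ((j == q.1)%:R *: sl_unit i q.2) (X i j * Y q.1 q.2) v); last first.
  by rewrite [LHS]pair_bigA.
transitivity (\sum_i \sum_l rho (sl_unit i l) ((X * Y) i l) v).
  by rewrite [RHS]pair_bigA.
apply: eq_bigr => i _.
transitivity (\sum_l \sum_j rho (sl_unit i l) (X i j * Y j l) v).
  by apply: eq_bigr => l _; rewrite mxE (linear_fun_sum (cact_linP rho _ v)).
rewrite exchange_big; apply: eq_bigr => j _ /=.
transitivity (\sum_k \sum_l rho ((j == k)%:R *: sl_unit i l) (X i j * Y k l) v);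
  last by rewrite [LHS]pair_bigA.
rewrite [RHS](bigD1 j) //= eqxx.
rewrite [Z in _ + Z]big1 ?addr0 => [|k /negPf kj].
  by apply: eq_bigr => l _; rewrite scale1r.
by apply: big1 => l _; rewrite eq_sym kj scale0r (linear_fun0 (cact_linx rho _ v)).
Qed.

(** The identity holds for each pair of matrix units, by [cact_comm] and [lie_sl_unit];
    commutativity of [A] matches the coefficients. *)
Lemma mx_cact_lie X Y v : mx_cact X (mx_cact Y v) - mx_cact Y (mx_cact X v) =
  mx_cact (X * Y) v - mx_cact (Y * X) v.
Proof.
have E Z W : mx_cact Z (mx_cact W v) =
    \sum_p \sum_(q : 'I_r.+1 * 'I_r.+1) rho (sl_unit p.1 p.2) (Z p.1 p.2)
      (rho (sl_unit q.1 q.2) (W q.1 q.2) v).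
  apply: eq_bigr => p _.
  by rewrite /mx_cact (linear_fun_sum (cact_lin rho _ _)).
rewrite !mx_cactM !E [Z in _ - Z = _]exchange_big [Z in _ = _ - Z]exchange_big /=.
rewrite -!sumrB; apply: eq_bigr => p _; rewrite -!sumrB; apply: eq_bigr => q _.
rewrite cact_comm addrC addKr lie_sl_unit (linear_funB (cact_linx rho _ v)).
by rewrite [Y _ _ * _]mulrC.
Qed.

Lemma mx_cact_delta (P : A) i j v :
  mx_cact (P *: delta_mx i j) v = rho (sl_unit i j) P v.
Proof.
rewrite /mx_cact (bigD1 (i, j)) //= !mxE !eqxx mulr1 big1 ?addr0 // => -[k l] kl.
rewrite !mxE (_ : _ && _ = false) ?mulr0 ?(linear_fun0 (cact_linP rho _ v)) //.
by apply: contraNF kl => /= /andP[/eqP -> /eqP ->].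
Qed.

Lemma mx_cact_sl (x : slr) (P : A) v :
  mx_cact (P *: map_mx iota x) v = rho x P v.
Proof.
rewrite -[in RHS](sum_sl_unit x) (linear_fun_sum (cact_linx rho P v)).
apply: eq_bigr => p _.
rewrite !mxE (linear_funZ (cact_linx rho P v)) -(linear_funZ (cact_linP rho _ v)).
by rewrite alg_scaleE mulrC.
Qed.
End CurrentSl.

(** * Highest weight vectors *)

Section CurrentSl2.
Variables (K : numFieldType) (N : lmodType K) (A : pzRingType).
Variables (E : N -> N) (F D : A -> N -> N) (H0 : N -> Prop) (kappa : nat).
Hypotheses (linE : linear E) (linF : forall P, linear (F P))
  (linD : forall P, linear (D P))
  (EF : forall P v, E (F P v) = F P (E v) + D P v)
  (DF : forall P Q v, D Q (F P v) = F P (D Q v) - 2%:R *: F (Q * P) v)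
  (DE : forall v, D 1 (E v) = E (D 1 v) + 2%:R *: E v)
  (H0D : forall P v, H0 v -> H0 (D P v))
  (H0E : forall v, H0 v -> E v = 0)
  (H0_weight : forall v, H0 v -> D 1 v = kappa%:R *: v).

(** The span of products of [k] lowering operators on vectors of [H0]. Linear combinations are built
    in because moving [D P] or [E] through a product creates sums. *)
Inductive lowered : nat -> N -> Prop :=
| lowered_hw v : H0 v -> lowered 0 v
| lowered_step k P v : lowered k v -> lowered k.+1 (F P v)
| lowered_zero k : lowered k 0
| lowered_lin k a u v : lowered k u -> lowered k v -> lowered k (a *: u + v).

Lemma loweredD k P v : lowered k v -> lowered k (D P v).
Proof.
move=> kv; elim: kv P => {k v} [v Hv|k Q v kv IH|k|k a u v ku IHu kv IHv] P.
- by apply: lowered_hw; apply: H0D.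
- rewrite DF addrC -scaleNr; apply: lowered_lin; first exact: lowered_step.
  by apply: lowered_step; apply: IH.
- by rewrite (linear_fun0 (linD P)); apply: lowered_zero.
- by rewrite linD; apply: lowered_lin.
Qed.

Lemma loweredE k v : lowered k v ->
  if k is k'.+1 then lowered k' (E v) else E v = 0.
Proof.
elim=> {k v} [v /H0E //|k P v kv IH|k|k a u v ku IHu kv IHv].
- rewrite EF -[F _ _]scale1r; apply: lowered_lin; last exact: loweredD.
  case: k kv IH => [|k] kv IH; last exact: lowered_step.
  by rewrite IH (linear_fun0 (linF P)); apply: lowered_zero.
- by rewrite (linear_fun0 linE); case: k => // k; apply: lowered_zero.
- case: k ku IHu kv IHv => [|k] ku IHu kv IHv; rewrite linE.
    by rewrite IHu IHv scaler0 addr0.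
  exact: lowered_lin.
Qed.

Lemma lowered_weight k v : lowered k v -> D 1 v = (kappa%:R - k.*2%:R) *: v.
Proof.
elim=> {k v} [v Hv|k P v kv IH|k|k a u v ku IHu kv IHv].
- by rewrite subr0 H0_weight.
- rewrite DF mul1r IH (linear_funZ (linF P)) -scalerBl; congr (_ *: _).
  by rewrite -!muln2 !natrM -natr1; ring.
- by rewrite (linear_fun0 (linD 1)) scaler0.
- by rewrite linD IHu IHv scalerDr !scalerA mulrC.
Qed.

Lemma lowered_iterE k j v : lowered k v ->
  D 1 (iter j E v) = (kappa%:R - k.*2%:R + j.*2%:R) *: iter j E v.
Proof.
move=> kv; elim: j => [|j IH] /=; first by rewrite addr0 (lowered_weight kv).
rewrite DE IH (linear_funZ linE) -scalerDl; congr (_ *: _).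
by rewrite doubleS -!natr1; ring.
Qed.

Lemma lowered_iterE_eq0 k v : lowered k v -> iter k.+1 E v = 0.
Proof.
elim: k v => [|k IH] v /loweredE // Ev.
by rewrite iterSr; apply: IH.
Qed.

(* E^(k+1) v = 0, and F 1 maps each E^(j+1) v to a multiple of E^j v, nonzero
   for j <= k, so that the vanishing descends to v. *)
Lemma lowered_lowest k v : (kappa < k)%N -> lowered k v -> F 1 v = 0 -> v = 0.
Proof.
move=> ltk kv Fv0; pose m : K := k.*2%:R - kappa%:R.
have FE j : F 1 (iter j.+1 E v) = (j.+1%:R * (m - j%:R)) *: iter j E v.
  have EF1 w : F 1 (E w) = E (F 1 w) - D 1 w by rewrite EF addrK.
  elim: j => [|j IH].
    rewrite /= EF1 Fv0 (linear_fun0 linE) (lowered_weight kv) sub0r -scaleNr.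
    by congr (_ *: _); rewrite /m; ring.
  rewrite [iter j.+2 _ _]iterS EF1 IH (linear_funZ linE) -iterS.
  rewrite (lowered_iterE _ kv) -scalerBl; congr (_ *: _).
  by rewrite /m -!muln2 !natrM -!natr1; ring.
have Ek0 := lowered_iterE_eq0 kv.
suff H j : (j <= k.+1)%N -> iter (k.+1 - j) E v = 0.
  by have := H k.+1 (leqnn _); rewrite subnn.
elim: j => [|j IH] jk; first by rewrite subn0.
have := FE (k - j)%N; rewrite -subSn // IH; last exact: ltnW.
rewrite (linear_fun0 (linF 1)) subSS => /esym.
set c := _ * _ => cE.
have c0 : c != 0.
  rewrite mulf_neq0 ?pnatr_eq0 ?subSn // /m -natrB; last by lia.
  by rewrite -natrB ?pnatr_eq0; lia.
by have /(congr1 ( *:%R c^-1)) := cE; rewrite scalerA mulVf // scale1r scaler0.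
Qed.

Hypothesis finite_weights : exists vals : seq K,
  forall c v, D 1 v = c *: v -> c \notin vals -> v = 0.

(** The weights [kappa - 2k] are pairwise distinct, so only finitely many occur and vectors of large
    depth vanish. Descending induction then applies [lowered_lowest], since [F 1 v] has depth
    [k + 1]. *)
Lemma lowered_eq0 k v : (kappa < k)%N -> lowered k v -> v = 0.
Proof.
have [vals valsP] := finite_weights.
have [k0 k0P] : exists k0, forall k : nat, (k0 <= k)%N ->
    (kappa%:R - k.*2%:R : K) \notin vals.
  elim: (vals) => [|c s [k0 k0P]]; first by exists 0%N.
  have [[k1 <-]|nc] := pselect (exists k : nat, kappa%:R - k.*2%:R = c).
    exists (maxn k0 k1.+1) => k'; rewrite geq_max => /andP[/k0P k0k k1k].
    rewrite inE negb_or k0k andbT; apply/eqP => /addrI/oppr_inj/eqP.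
    by rewrite eqr_nat; lia.
  exists k0 => k' /k0P k0k; rewrite inE negb_or k0k andbT; apply/eqP => ec.
  by apply: nc; exists k'.
have [j] := ubnP (k0 - k)%N; elim: j k v => // j IH k v.
rewrite ltnS => lej ltk kv; have [k0k|kk0] := leqP k0 k.
  by apply: valsP (lowered_weight kv) (k0P _ k0k).
apply: (lowered_lowest ltk kv); apply: (IH k.+1); try lia.
exact: lowered_step.
Qed.

Lemma foldr_lower_eq0 v ps : H0 v -> (kappa < size ps)%N -> foldr F v ps = 0.
Proof.
move=> Hv /lowered_eq0; apply; elim: ps => [|P ps IH] /=; first exact: lowered_hw.
exact: lowered_step.
Qed.
End CurrentSl2.

(** The values are the [mu i h]. If [d] is the decomposition of an eigenvector for [c], the vectors
    [(mu i h - c) *: d i] decompose 0, so each of them is zero by uniqueness. *)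
Lemma integrable_values (K : fieldType) r (V : lmodType K)
    (sigma : lie_rep (sl K r.+1) V) (h : cartan K r) : integrable sigma ->
  exists vals : seq K, forall c v, sigma h v = c *: v -> c \notin vals -> v = 0.
Proof.
case=> I [mu [_ _ dec]]; exists [seq mu i h | i <- enum I] => c v hv cvals.
have [d [[dw vd] _]] := dec v.
have lh := lact_linr sigma h.
have [e [[ew e0] eU]] := dec 0.
have e_0 : e = [ffun=> 0].
  apply: eU; split=> [i h'|].
    by rewrite ffunE (linear_fun0 (lact_linr _ _)) scaler0.
  by rewrite big1 // => i _; rewrite ffunE.
have d0 : e = [ffun i => (mu i h - c) *: d i].
  apply: eU; split=> [i h'|].
    by rewrite ffunE (linear_funZ (lact_linr _ _)) dw !scalerA mulrC.
  have v0 : sigma h v - c *: v = 0 by rewrite hv subrr.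
  rewrite -[LHS]v0 [in LHS]vd (linear_fun_sum lh) scaler_sumr -sumrB.
  by apply: eq_bigr => i _; rewrite ffunE dw scalerBl.
rewrite vd big1 // => i _.
have /ffunP/(_ i) := etrans (esym d0) e_0; rewrite !ffunE.
have mc : mu i h - c != 0.
  rewrite subr_eq0; apply: contraNneq cvals => <-.
  by apply: map_f; rewrite mem_enum.
move/(congr1 ( *:%R (mu i h - c)^-1)).
by rewrite scalerA mulVf // scale1r scaler0.
Qed.

(** * Operators annihilating the vectors of highest weight n omega_1 *)

Section HighestWeightVectors.
Variables (K : numFieldType) (A0 : comPzRingType) (iota : {rmorphism K -> A0}).
Variables (r n : nat).
Local Notation A := (alg_of iota).
Local Notation slr := (sl K r.+1).
Local Notation "''e_' ( i , j )" := (sl_unit K i j) (format "''e_' ( i ,  j )").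
Variables (N : lmodType K) (rho : cur_rep slr iota N).
Implicit Types (x y : slr) (P Q : A) (v : N) (h : cartan K r).

Definition hw_vector v : Prop :=
  (forall x P, in_nplus x -> rho x P v = 0) /\
  (forall h, rho h 1 v = weight_muln omega1 n h *: v).

Lemma hw_vector_subspace : is_subspace hw_vector.
Proof.
split=> [|a u v [un uh] [vn vh]].
  by split=> [x P _|h]; rewrite (linear_fun0 (cact_lin rho _ _)) ?scaler0.
split=> [x P xn|h]; rewrite cact_lin.
  by rewrite un // vn // scaler0 addr0.
by rewrite uh vh scalerDr !scalerA [a * _]mulrC.
Qed.

Lemma lie_nplus_cartan x h : in_nplus x -> in_nplus (lie x h).
Proof.
move=> xn i j ji /=; have /is_diag_mxP hd := cartan_diag h.
rewrite !mxE !big1 ?subrr // => k _.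
  by have [->|ik] := eqVneq k i; [rewrite xn // mulr0|rewrite hd ?mul0r // eq_sym].
by have [->|kj] := eqVneq k j; [rewrite xn // mul0r|rewrite hd ?mulr0].
Qed.

Lemma lie_cartan h1 h2 : lie (h1 : slr) (h2 : slr) = 0.
Proof.
have /is_diag_mxP d1 := cartan_diag h1; have /is_diag_mxP d2 := cartan_diag h2.
apply: val_inj; apply/matrixP => i j; rewrite /= !mxE; apply/eqP.
rewrite subr_eq0; apply/eqP; apply: eq_bigr => k _.
have [->|ki] := eqVneq k i.
  have [->|ij] := eqVneq i j; first by rewrite mulrC.
  by rewrite (d1 i j ij) (d2 i j ij) !mulr0.
by rewrite (d1 i k) 1?eq_sym // (d2 i k) 1?eq_sym // !mul0r.
Qed.

(** Brackets of the positive part with the Cartan subalgebra stay positive, and the Cartan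
    subalgebra is abelian. *)
Lemma hw_vector_cartan h P v : hw_vector v -> hw_vector (rho h P v).
Proof.
move=> [vn vh]; split=> [x Q xn|h'].
  rewrite cact_comm vn // (linear_fun0 (cact_lin rho _ _)) add0r.
  by apply: vn; apply: lie_nplus_cartan.
rewrite cact_comm lie_cartan (linear_fun0 (cact_linx rho _ _)) addr0 vh.
by rewrite (linear_funZ (cact_lin rho _ _)).
Qed.

Fact sl_diag_diag (a b : 'I_r.+1) : is_diag_mx ('e_(a, a) - 'e_(b, b) : slr).
Proof.
apply/is_diag_mxP => i j ij /=; rewrite !mxE.
have D (k : 'I_r.+1) : (i == k) && (j == k) = false.
  by apply/negP => /andP[/eqP ik /eqP jk]; rewrite ik jk eqxx in ij.
have ij' : (i == j) = false by apply/negP => /eqP e; rewrite e eqxx in ij.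
by rewrite !D ij' !mulr0n !subr0.
Qed.
Definition sl_diag a b : cartan K r := Cartan (sl_diag_diag a b).

Lemma sl_diag_lower a b : a != b ->
  lie (sl_diag a b : slr) 'e_(b, a) = - 2%:R *: 'e_(b, a).
Proof.
move=> /negPf ab; rewrite /= (linear_funB (lie_linl _)) !lie_sl_unit !eqxx ab.
by rewrite !scale0r !scale1r sub0r subr0 -opprD scaleNr scaler_nat.
Qed.

Lemma sl_diag_upper a b : a != b ->
  lie (sl_diag a b : slr) 'e_(a, b) = 2%:R *: 'e_(a, b).
Proof.
move=> /negPf ab; rewrite /= (linear_funB (lie_linl _)) !lie_sl_unit !eqxx eq_sym ab.
by rewrite !scale0r !scale1r sub0r subr0 opprK scaler_nat.
Qed.

Lemma sl_unit_nplus (a b : 'I_r.+1) : (a < b)%N -> in_nplus 'e_(a, b).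
Proof.
move=> ab i j ji; rewrite /= !mxE.
have /negPf -> : a != b by rewrite -val_eqE ltn_eqF.
rewrite mul0r mul0rn subr0; case: eqP => // ia; case: eqP => // jb.
by move: ji; rewrite ia jb leqNgt ab.
Qed.

Lemma omega1_sl_diag (a b : 'I_r.+1) : (a < b)%N ->
  weight_muln omega1 n (sl_diag a b) = ((a == ord0) * n)%N%:R.
Proof.
move=> ab; have b0 : (b == ord0) = false.
  by apply/negP => /eqP b0; rewrite b0 ltn0 in ab.
rewrite /= /weight_muln_fun /= /omega1_fun /= !mxE !eqxx !andbb !(eq_sym ord0).
by rewrite b0 opprB addrA subrK subr0 natrM mulr_natr.
Qed.

Hypothesis finite_weights : forall h, exists vals : seq K,
  forall c v, rho h 1 v = c *: v -> c \notin vals -> v = 0.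

(** The operators of the positive root [(a, b)] fit the sl_2 argument with [H0] the highest weight
    vectors; the weight on its coroot is [n] if [a] is 0, and 0 otherwise. *)
Lemma foldr_lower_hw (a b : 'I_r.+1) ps v : (a < b)%N -> hw_vector v ->
  ((a == ord0) * n < size ps)%N ->
  foldr (fun P => rho 'e_(b, a) P) v ps = 0.
Proof.
move=> ab; have nab : a != b by rewrite -val_eqE ltn_eqF.
apply: (foldr_lower_eq0 (H0 := hw_vector) (E := rho 'e_(a, b) 1)
  (D := fun P => rho (sl_diag a b) P)).
- exact: cact_lin.
- by move=> P; apply: cact_lin.
- by move=> P; apply: cact_lin.
- by move=> P {}v; rewrite cact_comm lie_sl_unit !eqxx !scale1r mul1r.
- move=> P Q {}v; rewrite cact_comm (sl_diag_lower nab).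
  by rewrite (linear_funZ (cact_linx rho _ _)) scaleNr.
- move=> {}v; rewrite cact_comm (sl_diag_upper nab) mul1r.
  by rewrite (linear_funZ (cact_linx rho _ _)).
- by move=> P {}v; apply: hw_vector_cartan.
- by move=> {}v [vn _]; apply: vn; apply: sl_unit_nplus.
- by move=> {}v [_ vh]; rewrite vh omega1_sl_diag.
exact: finite_weights.
Qed.

(** Above the diagonal the operator is positive. Below it, [j != ord0] makes the sl_2 weight zero,
    so one lowering operator already annihilates. *)
Lemma hw_sl_unit_eq0 (i j : 'I_r.+1) P v : i != j -> j != ord0 -> hw_vector v ->
  rho 'e_(i, j) P v = 0.
Proof.
move=> ij j0 hv; have [ltij|ltji|eij] := ltngtP i j.
- by case: hv => vn _; apply: vn; apply: sl_unit_nplus.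
- by apply: (foldr_lower_hw (ps := [:: P]) ltji hv); rewrite (negPf j0).
- by rewrite (val_inj eij) eqxx in ij.
Qed.

(** The diagonal difference is the bracket of two opposite matrix units, both of which annihilate
    the vector. *)
Lemma hw_sl_diag_eq0 (i j : 'I_r.+1) P v : i != ord0 -> j != ord0 -> hw_vector v ->
  rho (sl_diag i j) P v = 0.
Proof.
move=> i0 j0 hv; have [<-|ij] := eqVneq i j.
  by rewrite /= subrr (linear_fun0 (cact_linx rho _ _)).
have -> : (sl_diag i j : slr) = lie 'e_(i, j) 'e_(j, i).
  by rewrite lie_sl_unit !eqxx !scale1r.
have := cact_comm rho 'e_(i, j) 1 'e_(j, i) P v.
have -> : rho 'e_(i, j) 1 v = 0 by apply: hw_sl_unit_eq0.
have -> : rho 'e_(j, i) P v = 0 by apply: hw_sl_unit_eq0 => //; rewrite eq_sym.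
by rewrite mul1r !(linear_fun0 (cact_lin rho _ _)) add0r => <-.
Qed.
End HighestWeightVectors.

(** * Matrices over A acting on maps out of the highest weight vectors *)

Section HwVectorModule.
Variables (K : numFieldType) (A0 : comPzRingType) (iota : {rmorphism K -> A0}).
Variables (r n : nat).
Local Notation A := (alg_of iota).
Local Notation slr := (sl K r.+1).
Local Notation "''e_' ( i , j )" := (sl_unit K i j) (format "''e_' ( i ,  j )").
Variables (N : lmodType K) (rho : cur_rep slr iota N).

(** A submodule in its own right, so that linear maps from all highest weight vectors to [N] can be
    formed and operators can act on their arguments. *)
Record hwv := HwVector { hwv_val :> N; hwv_prop : `[< hw_vector n rho hwv_val >] }.
HB.instance Definition _ := [isSub for hwv_val].
HB.instance Definition _ := [Choice of hwv by <:].

Fact hwv_submod_closed : submod_closed (fun v : N => `[< hw_vector n rho v >]).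
Proof.
have [H0 Hl] := hw_vector_subspace n rho.
by split=> [|a u v /asboolP uh /asboolP vh]; apply/asboolP => //; apply: Hl.
Qed.
HB.instance Definition _ :=
  GRing.SubChoice_isSubLmodule.Build K _ _ hwv hwv_submod_closed.

Lemma hwvP (u : hwv) : hw_vector n rho u.
Proof. by case: u => u /= /asboolP. Qed.

Lemma hwv_linear : linear (hwv_val : hwv -> N).
Proof. exact: (linearP (val : hwv -> N)). Qed.

Lemma hwv_inj : injective (hwv_val : hwv -> N).
Proof. exact: val_inj. Qed.

Variable i1 : 'I_r.+1.

Definition hwv_cartan (P : A) (u : hwv) : hwv :=
  HwVector (asboolT (hw_vector_cartan (sl_diag K ord0 i1) P (hwvP u))).

Lemma hwv_cartanE P u : hwv_cartan P u = rho (sl_diag K ord0 i1) P u :> N.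
Proof. by []. Qed.

Lemma hwv_cartan_linear P : linear (hwv_cartan P).
Proof.
by move=> a u v; apply: hwv_inj; rewrite hwv_linear !hwv_cartanE hwv_linear cact_lin.
Qed.

Lemma hwv_cartan_linl u : linear (hwv_cartan^~ u).
Proof.
by move=> a P Q; apply: hwv_inj; rewrite hwv_linear !hwv_cartanE cact_linP.
Qed.

Lemma hwv_cartanC P Q u :
  hwv_cartan P (hwv_cartan Q u) = hwv_cartan Q (hwv_cartan P u).
Proof.
apply: hwv_inj; rewrite !hwv_cartanE cact_comm liexx.
by rewrite (linear_fun0 (cact_linx rho _ _)) addr0.
Qed.

Local Notation F := (lmap hwv N).
Definition mean_tr (b : 'M[A]_r.+1) : A := (r.+1%:R^-1 : K) *: (\tr b : A).

Lemma mean_tr_lin a b c :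
  mean_tr ((iota a : A)%:M * b + c) = a *: mean_tr b + mean_tr c.
Proof.
rewrite /mean_tr mxtraceD [_%:M * b]mul_scalar_mx mxtraceZ scalerDr.
by rewrite -(alg_scaleE a) !scalerA mulrC.
Qed.

Fact mx_act_subproof (b : 'M[A]_r.+1) (phi : F) :
  linear (fun u => mx_cact rho b (phi u) + phi (hwv_cartan (mean_tr b) u)).
Proof.
apply: linear_add; first exact: linear_compose (mx_cact_linr _ _) (lmap_linear phi).
exact: linear_compose (lmap_linear phi) (@hwv_cartan_linear _).
Qed.

(* A matrix acts through its traceless part on the values, while its scalar
   part, which has to be central, acts by the Cartan element E_00 - E_11 on the
   arguments: this extends the action of the traceless matrices to all of
   them. *)
Definition mx_act b (phi : F) : F := LMap (mx_act_subproof b phi).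

Lemma mx_actE b phi u : mx_act b phi u =
  mx_cact rho b (phi u) + phi (hwv_cartan (mean_tr b) u).
Proof. by []. Qed.

Lemma mx_act_linl a b c phi :
  mx_act ((iota a : A)%:M * b + c) phi = a *: mx_act b phi + mx_act c phi.
Proof.
apply: lmapP => u; rewrite lmapDE lmapZE !mx_actE mx_cact_linl.
by rewrite mean_tr_lin hwv_cartan_linl lmap_linear scalerDr addrACA.
Qed.

Lemma mx_act_linr b : linear (mx_act b).
Proof.
move=> a f g; apply: lmapP => u; rewrite lmapDE lmapZE !mx_actE !lmapDE !lmapZE.
by rewrite mx_cact_linr scalerDr addrACA.
Qed.

(** On values this is [mx_cact_lie]. The operators on arguments commute with each other and with
    those on values, and [b * c] and [c * b] have the same trace. *)
Lemma mx_act_lie b c phi :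
  mx_act b (mx_act c phi) - mx_act c (mx_act b phi) =
  mx_act (b * c) phi - mx_act (c * b) phi.
Proof.
apply: lmapP => u; rewrite !(lmapDE, lmapNE) !mx_actE.
rewrite !(linear_funD (mx_cact_linr rho _)).
have -> : mean_tr (c * b) = mean_tr (b * c) by rewrite /mean_tr mxtrace_mulC.
rewrite [hwv_cartan (mean_tr c) (hwv_cartan _ _)]hwv_cartanC.
rewrite !opprD [RHS]addrACA subrr addr0 -mx_cact_lie.
rewrite !addrA [LHS](AC 8 ((1*5)*((2*7)*(3*6)*(4*8)))) /=.
by rewrite !subrr !addr0.
Qed.

Definition hwv_incl : F := LMap hwv_linear.

(** The traceless diagonal units sum to zero, so averaging the differences over [k] recovers the
    unit itself. *)
Lemma sl_unit_diag i : 'e_(i, i) = r.+1%:R^-1 *: \sum_k (sl_diag K i k : slr).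
Proof.
rewrite /= sumrB sumr_const card_ord -scaler_nat.
suff -> : \sum_k 'e_(k, k) = 0 :> slr.
  by rewrite subr0 scalerA mulVf ?pnatr_eq0 // scale1r.
apply: val_inj; rewrite linear_sum /=; apply/matrixP => s t.
rewrite summxE mxE (eq_bigr (fun k => ((s == k) && (t == k))%:R -
  (r.+1%:R^-1 : K) *+ (s == t))) => [|k _]; last by rewrite !mxE eqxx mul1r.
rewrite sumrB sumr_const card_ord -mulrnA mulnC mulrnA -[_ *+ r.+1]mulr_natr.
rewrite mulVf ?pnatr_eq0 // (bigD1 s) //= eqxx big1 => [|k /negPf ks].
  by rewrite addr0 eq_sym subrr.
by rewrite eq_sym ks.
Qed.

Hypotheses (i1_neq0 : i1 != ord0)
  (finite_weights : forall h : cartan K r, exists vals : seq K,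
     forall c v, rho h 1 v = c *: v -> c \notin vals -> v = 0).

Lemma hwv_diag i P (u : hwv) : i != ord0 ->
  rho 'e_(i, i) P u = - (r.+1%:R^-1 *: (hwv_cartan P u : N)).
Proof.
move=> i0; have lt := cact_linx rho P u; rewrite sl_unit_diag.
rewrite (linear_funZ lt) (linear_fun_sum lt) (bigD1 ord0) //= big1 => [|k k0].
  rewrite addr0 -scalerN; congr (_ *: _).
  have -> : ('e_(i, i) - 'e_(ord0, ord0) : slr) =
      (sl_diag K i i1 : slr) - (sl_diag K ord0 i1 : slr).
    by rewrite /= opprB addrA subrK.
  rewrite (linear_funB lt) (hw_sl_diag_eq0 finite_weights _ i0 i1_neq0 (hwvP u)).
  by rewrite sub0r.
exact: (hw_sl_diag_eq0 finite_weights _ i0 k0 (hwvP u)).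
Qed.

(** Off the diagonal everything vanishes by [hw_sl_unit_eq0] or because column 0 is zero. By
    [hwv_diag], the diagonal entries contribute exactly the opposite of the Cartan term for
    [mean_tr b], which is what the twist in [mx_act] is made for. *)
Lemma mx_act_incl_eq0 (b : 'M[A]_r.+1) :
  (forall i, b i ord0 = 0) -> mx_act b hwv_incl = 0.
Proof.
move=> b0; apply: lmapP => u; rewrite mx_actE lmap0E.
have -> : mx_cact rho b (hwv_incl u) = \sum_i rho 'e_(i, i) (b i i) u.
  transitivity (\sum_i \sum_j rho 'e_(i, j) (b i j) u).
    by rewrite [RHS]pair_bigA.
  apply: eq_bigr => i _; rewrite (bigD1 i) //= big1 ?addr0 // => j ji.
  have [->|j0] := eqVneq j ord0; last first.
    by apply: (hw_sl_unit_eq0 finite_weights _ _ j0 (hwvP u)); rewrite eq_sym.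
  by rewrite b0 (linear_fun0 (cact_linP rho _ _)).
have lc := cact_linP rho (sl_diag K ord0 i1) u.
rewrite [X in _ + X]hwv_cartanE /mean_tr (linear_funZ lc).
rewrite /mxtrace (linear_fun_sum lc).
rewrite scaler_sumr -big_split /= big1 // => i _.
have [->|i0] := eqVneq i ord0; last by rewrite hwv_diag // hwv_cartanE addNr.
by rewrite b0 !(linear_fun0 (cact_linP rho _ _)) scaler0 addr0.
Qed.

(** The traceless part acts by [r * n / (r + 1)] and the Cartan term adds [n / (r + 1)]. *)
Lemma mx_act_incl_top : mx_act (delta_mx ord0 ord0) hwv_incl = n%:R *: hwv_incl.
Proof.
apply: lmapP => u; rewrite mx_actE lmapZE [X in _ + X]hwv_cartanE.
have wt k : k != ord0 -> rho (sl_diag K ord0 k) 1 (u : N) = n%:R *: (u : N).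
  move=> k0; have [_ ->] := hwvP u; rewrite omega1_sl_diag ?lt0n //.
  by rewrite eqxx mul1n.
rewrite -[delta_mx _ _]scale1r mx_cact_delta.
have -> : mean_tr (1 *: delta_mx ord0 ord0) = r.+1%:R^-1 *: (1 : A).
  rewrite /mean_tr scale1r /mxtrace (bigD1 ord0) //= mxE eqxx big1 ?addr0 // => k k0.
  by rewrite mxE (negPf k0).
rewrite (linear_funZ (cact_linP rho _ _)) (wt _ i1_neq0).
have lt := cact_linx rho 1 (u : N); rewrite sl_unit_diag.
rewrite (linear_funZ lt) (linear_fun_sum lt) -scalerDr (bigD1 ord0) //=.
rewrite subrr (linear_fun0 lt) add0r.
rewrite (eq_bigr (fun=> n%:R *: (u : N))) => [|k k0]; last exact: wt.
rewrite sumr_const cardC1 card_ord -scaler_nat -[X in _ + X]scale1r -scalerDl.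
by rewrite natr1 scalerA mulVf ?pnatr_eq0 // scale1r.
Qed.

Lemma mx_act_lower ps : size ps = n.+1 ->
  foldr mx_act hwv_incl [seq P *: delta_mx i1 ord0 | P <- ps] = 0.
Proof.
move=> sps; apply: lmapP => u; rewrite lmap0E.
transitivity (foldr (fun P => rho 'e_(i1, ord0) P) (hwv_val u) ps).
  elim: ps {sps} => // P ps IH.
  rewrite map_cons -[foldr _ _ (_ :: _)]/(mx_act _ _) mx_actE mx_cact_delta IH.
  have -> : mean_tr (P *: delta_mx i1 ord0) = 0.
    rewrite /mean_tr mxtraceZ /mxtrace big1 ?mulr0 ?scaler0 // => k _.
    rewrite mxE; case: eqP => // ->.
    by rewrite (negPf i1_neq0).
  by rewrite (linear_fun0 (hwv_cartan_linl _)) (linear_fun0 (lmap_linear _)) addr0.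
apply: (foldr_lower_hw finite_weights _ (hwvP u)).
  by rewrite lt0n.
by rewrite eqxx mul1n sps.
Qed.
End HwVectorModule.

(** * The morphism from the symmetric power *)

Section Columns.
Variables (K : fieldType) (A0 : comPzRingType) (iota : {rmorphism K -> A0}).
Variable m : nat.
Local Notation A := (alg_of iota).
Local Notation VA := (tensor 'cV[K]_m A).
Local Notation rhoV := (tensor_rep iota (vec_rep K m)).

Definition tens_coord (i : 'I_m) : VA -> A :=
  tensor_lift (fun (w : 'cV[K]_m) (P : A) => w i ord0 *: P).

Fact tens_coord_linl i (P : A) : linear (fun w : 'cV[K]_m => w i ord0 *: P).
Proof. by move=> a u v; rewrite !mxE scalerDl scalerA. Qed.
Fact tens_coord_linr i (w : 'cV[K]_m) : linear (fun P : A => w i ord0 *: P).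
Proof. by move=> a P Q; rewrite scalerDr !scalerA mulrC. Qed.

Lemma tens_coordE i w P : tens_coord i (w ⊗t P) = w i ord0 *: P.
Proof.
exact: (tensor_liftE (b := fun (w : 'cV[K]_m) (P : A) => w i ord0 *: P)
  (tens_coord_linl i) (tens_coord_linr i)).
Qed.

Lemma tens_coord_linear i : linear (tens_coord i).
Proof.
exact: (tensor_lift_linear (b := fun (w : 'cV[K]_m) (P : A) => w i ord0 *: P)
  (tens_coord_linl i) (tens_coord_linr i)).
Qed.

Definition col_of_tens (y : VA) : 'cV[A]_m := \col_i tens_coord i y.

Lemma col_of_tens_lin a u v :
  col_of_tens (a *: u + v) = (iota a : A) *: col_of_tens u + col_of_tens v.
Proof. by apply/colP => i; rewrite !mxE tens_coord_linear. Qed.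

Lemma col_of_tens_act (x : sl K m) (P : A) y :
  col_of_tens (rhoV (x ⊗t P) y) = (P *: map_mx iota x) *m col_of_tens y.
Proof.
apply/colP => i; rewrite !mxE.
transitivity (\sum_k (x i k : K) *: (P * tens_coord k y)); last first.
  apply: eq_bigr => k _; rewrite !mxE alg_scaleE mulrA; congr (_ * _).
  exact: mulrC.
move: y; apply: linear_fun_eq => [||w Q].
- exact: linear_compose (tens_coord_linear i) (lact_linr _ _).
- move=> a u v; rewrite scaler_sumr -big_split; apply: eq_bigr => k _ /=.
  by rewrite tens_coord_linear alg_mul_linr scalerDr !scalerA mulrC.
rewrite tensor_repE tens_coordE mxE scaler_suml; apply: eq_bigr => k _.
by rewrite tens_coordE (linear_funZ (alg_mul_linr P)) scalerA.
Qed.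
End Columns.

Section HomFromSymmetricPower.
Variables (K : numFieldType) (A0 : comPzRingType) (iota : {rmorphism K -> A0}).
Variables (r n : nat) (i1 : 'I_r.+1) (i1_neq0 : i1 != ord0).
Local Notation A := (alg_of iota).
Local Notation slr := (sl K r.+1).
Local Notation gA := (tensor slr A).
Local Notation VA := (tensor 'cV[K]_r.+1 A).
Local Notation rhoS := (sym_rep n (tensor_rep iota (vec_rep K r.+1))).
Variables (N : lmodType K) (rho : lie_rep gA N) (u0 : N).
Hypothesis hw_u0 : highest_weight_module (weight_muln omega1 n) rho u0.

Let c := cur_rep_of rho.

Fact hwm_hw_vector : hw_vector n c u0.
Proof. by case: hw_u0 => _ _ un uh; split. Qed.

Let u : hwv n c := HwVector (asboolT hwm_hw_vector).

Fact hwm_finite_weights (h : cartan K r) : exists vals : seq K,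
  forall a v, c h 1 v = a *: v -> a \notin vals -> v = 0.
Proof.
have [int_rho _ _ _] := hw_u0.
exact: (integrable_values h int_rho).
Qed.

Let act := mx_act (rho := c) i1 (n := n).
Let phi0 := hwv_incl n c.
Local Notation coltens := (@col_of_tens K A0 iota r.+1).

(** The polarization yields a map on highest weight vectors; its value at the generator is the
    desired vector of [N]. *)
Definition hwm_polar (s : seq VA) : N :=
  (cpolar act phi0 (map coltens s) : lmap (hwv n c) N) u.

Lemma hwm_polar_perm s t : perm_eq s t -> hwm_polar s = hwm_polar t.
Proof.
move=> st; rewrite /hwm_polar.
by rewrite (cpolar_perm phi0 (mx_act_linr i1) (mx_act_lie i1) (perm_map _ st)).
Qed.

Lemma hwm_polar_lin s1 a v w s2 : hwm_polar (s1 ++ (a *: v + w) :: s2) =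
  a *: hwm_polar (s1 ++ v :: s2) + hwm_polar (s1 ++ w :: s2).
Proof.
rewrite /hwm_polar !map_cat /= col_of_tens_lin.
have E := @cpolar_lin K A iota r _ act phi0 (@mx_act_linl _ _ _ _ _ _ _ i1)
  (mx_act_linr i1) (map coltens s1) a (col_of_tens v) (col_of_tens w)
  (map coltens s2).
exact: (congr1 (fun f : lmap (hwv n c) N => f u) E).
Qed.

Lemma hwm_polar_act (x : slr) P s : size s = n ->
  rho (x ⊗t P) (hwm_polar s) =
  lderiv (tensor_rep iota (vec_rep K r.+1) (x ⊗t P)) hwm_polar s.
Proof.
move=> ss; set X : 'M[A]_r.+1 := P *: map_mx iota x.
have tX : mean_tr X = 0.
  rewrite /mean_tr mxtraceZ (_ : \tr _ = iota (\tr (x : 'M_r.+1))).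
    by have /eqP -> := sl_tr x; rewrite rmorph0 mulr0 scaler0.
  by rewrite /mxtrace rmorph_sum; apply: eq_bigr => i _; rewrite mxE.
(* As [X] is traceless, the term on the arguments vanishes and [act X] is the action of [x ⊗t P] on
   the value. *)
transitivity (act X (cpolar act phi0 (map coltens s)) u).
  rewrite mx_actE tX (linear_fun0 (hwv_cartan_linl _ _)).
  by rewrite (linear_fun0 (lmap_linear _)) addr0 /X mx_cact_sl.
have E := @act_cpolar_size K A iota r _ act phi0 (@mx_act_linl _ _ _ _ _ _ _ i1)
  (mx_act_linr i1) (mx_act_lie i1) (mx_act_incl_eq0 n i1_neq0 hwm_finite_weights)
  i1 n i1_neq0 (mx_act_lower i1_neq0 hwm_finite_weights) X
  (map coltens s).
rewrite E ?size_map //.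
rewrite (lderiv_map (op' := tensor_rep iota (vec_rep K r.+1) (x ⊗t P))); last first.
  by move=> y; rewrite col_of_tens_act.
by rewrite -(@lderiv_comp_linear _ _ N _ (fun f : lmap (hwv n c) N => f u)).
Qed.

Let v0 : VA := (delta_mx ord0 ord0 : 'cV[K]_r.+1) ⊗t (1 : A).

Lemma hwm_polar_top : hwm_polar (nseq n v0) = n`!%:R *: u0.
Proof.
rewrite /hwm_polar map_nseq /cpolar map_nseq.
have -> : col0_mx (col_of_tens v0) = delta_mx ord0 ord0.
  rewrite -[RHS](mul_delta_mx (ord0 : 'I_1)); congr (_ *m _); apply/colP => i.
  rewrite !mxE tens_coordE !mxE andbT alg_scaleE mulr1.
  by case: eqP; rewrite ?rmorph1 ?rmorph0.
rewrite (@polar_eigen _ _ _ _ _ (@mx_act_linr _ _ _ _ _ _ _ i1) _ n).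
- by rewrite lmapZE ffactnn.
- by rewrite [LHS]mul_delta_mx.
exact: mx_act_incl_top.
Qed.

(** The factor is dictated by [hwm_polar_top]: it sends the power of [v0] to [u0] itself. *)
Definition hwm_mul (f : {ffun 'I_n -> VA}) : N :=
  n`!%:R^-1 *: hwm_polar [seq f i | i <- enum 'I_n].

Lemma enum_upd (f : {ffun 'I_n -> VA}) i : exists s1 s2, forall v,
  [seq upd f i v j | j <- enum 'I_n] = s1 ++ v :: s2.
Proof.
have : i \in enum 'I_n by rewrite mem_enum.
have := enum_uniq 'I_n; move: (enum _) => s us si; case/splitPr: si us => s1 s2.
rewrite cat_uniq /= negb_or => /and3P[_ /andP[is1 _] /andP[is2 _]].
exists (map f s1), (map f s2) => v; rewrite map_cat /= upd_at; congr (_ ++ _ :: _).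
  by apply/eq_in_map => j js; rewrite upd_out //; apply: contraNneq is1 => <-.
by apply/eq_in_map => j js; rewrite upd_out //; apply: contraNneq is2 => <-.
Qed.

Lemma hwm_mul_lin (f : {ffun 'I_n -> VA}) i a v w :
  hwm_mul (upd f i (a *: v + w)) = a *: hwm_mul (upd f i v) + hwm_mul (upd f i w).
Proof.
have [s1 [s2 E]] := enum_upd f i.
by rewrite /hwm_mul !E hwm_polar_lin scalerDr !scalerA mulrC.
Qed.

Lemma hwm_mul_perm (f : {ffun 'I_n -> VA}) (s : 'S_n) :
  hwm_mul [ffun i => f (s i)] = hwm_mul f.
Proof.
rewrite /hwm_mul; congr (_ *: _); apply: hwm_polar_perm.
rewrite (eq_map (g := f \o s)) => [|i]; last by rewrite ffunE.
rewrite map_comp; apply: perm_map; apply: uniq_perm.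
- by rewrite (map_inj_uniq (@perm_inj _ s)) enum_uniq.
- exact: enum_uniq.
move=> i; rewrite mem_enum; apply/mapP; exists (s^-1%g i); first by rewrite mem_enum.
by rewrite permKV.
Qed.

Lemma hwm_mul_act (x : slr) P (f : {ffun 'I_n -> VA}) : rho (x ⊗t P) (hwm_mul f) =
  \sum_i hwm_mul (upd f i (tensor_rep iota (vec_rep K r.+1) (x ⊗t P) (f i))).
Proof.
rewrite /hwm_mul (linear_funZ (lact_linr rho _)) hwm_polar_act; last first.
  by rewrite size_map size_enum_ord.
rewrite lderiv_uniq ?enum_uniq // scaler_sumr big_enum /=; apply: eq_bigr => i _.
congr (_ *: hwm_polar _); apply: eq_map => j.
by have [->|ji] := eqVneq j i; [rewrite upd_at | rewrite upd_out].
Qed.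

Lemma hwm_from_sympower : exists Phi : {linear symp n VA -> N},
  rep_hom rhoS rho Phi /\
  Phi (spow n v0) = u0.
Proof.
have lin := symp_lift_linear hwm_mul_lin hwm_mul_perm.
have liftE := symp_liftE hwm_mul_lin hwm_mul_perm.
have hom x m : symp_lift hwm_mul (rhoS x m) = rho x (symp_lift hwm_mul m).
  move: x; apply: linear_fun_eq => [||x P].
  - exact: linear_compose lin (lact_linl rhoS m).
  - exact: lact_linl.
  move: m; apply: symp_linear_eq => [||f].
  - exact: linear_compose lin (lact_linr rhoS _).
  - exact: linear_compose (lact_linr rho _) lin.
  rewrite sym_repE (linear_fun_sum lin) liftE hwm_mul_act.
  by apply: eq_bigr => i _; rewrite liftE.
pose PhiL := GRing.isLinear.Build K _ _ _ (symp_lift hwm_mul) lin.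
pose Phi : {linear symp n VA -> N} := HB.pack (symp_lift hwm_mul) PhiL.
exists Phi; split; first exact: hom.
rewrite /Phi /= /spow liftE /hwm_mul.
rewrite (_ : map _ _ = nseq n v0).
  by rewrite hwm_polar_top scalerA mulVf ?scale1r // pnatr_eq0 -lt0n fact_gt0.
rewrite (eq_map (g := fun=> v0)) => [|i]; last by rewrite ffunE.
by rewrite -[in RHS](size_enum_ord n); elim: (enum _) => //= _ s ->.
Qed.
End HomFromSymmetricPower.

(** * The symmetric power as a highest weight module *)

Section WeightDecomposition.
Variables (K : fieldType) (r : nat) (V : lmodType K).
Variable sigma : lie_rep (sl K r.+1) V.

(** For each [j] other than [i0] some [h j] separates the two weights. The composite of the
    operators [h j - mu j (h j)] kills every other summand and multiplies [e i0] by a nonzero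
    scalar. *)
Lemma weight_vectors_free (I : finType) (mu : I -> weight K r) (e : I -> V) :
  (forall i j, mu i =1 mu j -> i = j) ->
  (forall i, weight_space sigma (mu i) (e i)) -> \sum_i e i = 0 ->
  forall i, e i = 0.
Proof.
move=> mu_inj ew e0 i0.
have [h hP] : {h : I -> cartan K r &
    forall j, j != i0 -> mu i0 (h j) != mu j (h j)}.
  apply: (choice (P := fun j x => j != i0 -> mu i0 x != mu j x)) => j.
  have [->|ji] := eqVneq j i0; first by exists 0.
  apply: contrapT => nex; case/negP: ji; apply/eqP; apply: mu_inj => x.
  by apply/esym/eqP; apply: contrapT => /negP nx; apply: nex; exists x.
pose T s v := foldr (fun j v => sigma (h j) v - mu j (h j) *: v) v s.
have TC j s v : T (j :: s) v = sigma (h j) (T s v) - mu j (h j) *: T s v by [].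
have linT s : linear (T s).
  elim: s => [|j s IH] // a u v; rewrite !TC IH lact_linr scalerDr scalerBr.
  by rewrite !scalerA [mu j _ * a]mulrC opprD addrACA.
have TE s k : T s (e k) = (\prod_(j <- s) (mu k (h j) - mu j (h j))) *: e k.
  elim: s => [|j s IH]; first by rewrite big_nil scale1r.
  rewrite big_cons TC IH (linear_funZ (lact_linr _ _)) ew !scalerA -scalerBl.
  by congr (_ *: _); rewrite mulrC -mulrBl.
pose s := [seq j <- enum I | j != i0].
have := linear_fun0 (linT s); rewrite -e0 (linear_fun_sum (linT s)) (bigD1 i0) //=.
rewrite big1 => [|k ki]; last first.
  rewrite TE; apply/eqP; rewrite scaler_eq0 prodf_seq_eq0; apply/orP; left.
  apply/hasP; exists k; first by rewrite mem_filter ki mem_enum.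
  by rewrite /= subrr.
rewrite addr0 TE => /eqP; rewrite e0.
set c := \prod_(j <- s) _ => /eqP ce.
have c0 : c != 0.
  rewrite prodf_seq_neq0; apply/allP => j; rewrite mem_filter => /andP[ji _] /=.
  by rewrite subr_eq0 hP.
by have /(congr1 ( *:%R c^-1)) := ce; rewrite scalerA mulVf // scale1r scaler0.
Qed.

(** Weights indexed by [J] may coincide, so components of equal weight are grouped under one
    representative; uniqueness then comes from [weight_vectors_free]. *)
Lemma integrable_of_weight_vectors (J : finType) (mu : J -> weight K r) :
  (forall j, integral_weight (mu j)) ->
  (forall v, exists c : J -> V,
     (forall j, weight_space sigma (mu j) (c j)) /\ v = \sum_j c j) ->
  integrable sigma.
Proof.
move=> mu_int dec.
(* The search always succeeds, [j] being a candidate, and its result depends only on the weight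
   [mu j]. *)
pose rep j := odflt j [pick k | `[< mu k =1 mu j >]].
have repE j : mu (rep j) =1 mu j.
  by rewrite /rep; case: pickP => [k /asboolP //|].
have repK j k : mu j =1 mu k -> rep j = rep k.
  move=> jk; rewrite /rep (eq_pick (Q := fun l => `[< mu l =1 mu k >])).
    by case: pickP => // /(_ k)/asboolP.
  by move=> l; apply/asboolP/asboolP => H x; rewrite H // jk.
pose I : finType := {j : J | rep j == j}.
have pP j : rep (rep j) == rep j by apply/eqP; apply: repK.
pose p j : I := exist _ (rep j) (pP j).
have mu_inj (i j : I) : mu (val i) =1 mu (val j) -> i = j.
  by move=> /repK; rewrite (eqP (valP i)) (eqP (valP j)) => /val_inj.
exists I, (fun i => mu (val i)); split=> // v.
have [c [cw vc]] := dec v.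
exists [ffun i => \sum_(j | p j == i) c j]; split.
  split=> [i h|]; last first.
    rewrite vc (partition_big p predT) //=.
    by apply: eq_bigr => i _; rewrite ffunE.
  rewrite ffunE (linear_fun_sum (lact_linr _ _)) scaler_sumr.
  by apply: eq_bigr => j /eqP <-; rewrite cw /= repE.
move=> d [dw vd]; set c' := [ffun i => _].
have c'w i : weight_space sigma (mu (val i)) (c' i).
  move=> h; rewrite ffunE (linear_fun_sum (lact_linr _ _)) scaler_sumr.
  by apply: eq_bigr => j /eqP <-; rewrite cw /= repE.
have vc' : v = \sum_i c' i.
  rewrite vc (partition_big p predT) //=.
  by apply: eq_bigr => i _; rewrite ffunE.
apply/ffunP => i; apply/eqP; rewrite -subr_eq0; apply/eqP.
apply: (weight_vectors_free (mu := fun i : I => mu (val i))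
  (e := fun i => c' i - d i)) => //.
- move=> k h; rewrite (linear_funB (lact_linr _ _)) c'w dw.
  by rewrite scalerBr.
by rewrite sumrB -vc' -vd subrr.
Qed.
End WeightDecomposition.

(** * Induction, eigenvectors and generation in symmetric powers *)

Section SymmetricPowerFacts.
Variables (K : numFieldType) (n : nat) (V : lmodType K).

Lemma upd_id (f : {ffun 'I_n -> V}) i : upd f i (f i) = f.
Proof. by apply/ffunP => j; rewrite ffunE; case: eqP => [->|]. Qed.

(** Entries are freed one at a time: at stage [k] the first [k] are arbitrary and the others lie in
    [S]. *)
Lemma symp_ind_gen (S : V -> Prop) (W : symp n V -> Prop) :
  (forall X : V -> Prop, is_subspace X -> (forall s, S s -> X s) -> forall v, X v) ->
  is_subspace W ->
  (forall f : {ffun 'I_n -> V}, (forall i, S (f i)) -> W (sprod f)) ->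
  forall m, W m.
Proof.
move=> spanS [W0 Wl] WS; apply: symp_ind => // f.
suff H k : forall f : {ffun 'I_n -> V},
    (forall i : 'I_n, (k <= i)%N -> S (f i)) -> W (sprod f).
  by apply: (H n) => i; rewrite leqNgt ltn_ord.
elim: k => [|k IH] {}f fS; first by apply: WS => i; apply: fS.
have [lek|ltk] := leqP n k.
  by apply: IH => i; rewrite leqNgt (leq_trans (ltn_ord i) lek).
pose i := Ordinal ltk; rewrite -(upd_id f i).
apply: (spanS (fun v => W (sprod (upd f i v)))) => [|v Sv]; last first.
  apply: IH => j kj; have [->|ji] := eqVneq j i; first by rewrite upd_at.
  by rewrite upd_out //; apply: fS; rewrite ltn_neqAle kj andbT eq_sym.
split=> [|a u v Wu Wv]; last by rewrite sprod_lin; apply: Wl.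
by have /linear_fun0 -> := sprod_upd_lin f i.
Qed.

Variables (L : lieAlgType K) (rho : lie_rep L V).

Lemma sym_rep_eigen (x : L) (f : {ffun 'I_n -> V}) (a : 'I_n -> K) :
  (forall i, rho x (f i) = a i *: f i) ->
  sym_rep n rho x (sprod f) = (\sum_i a i) *: sprod f.
Proof.
move=> fa; rewrite sym_repE scaler_suml; apply: eq_bigr => i _.
by rewrite fa (linear_funZ (sprod_upd_lin f i)) upd_id.
Qed.

(** Induction on the number [k] of leading entries that may differ from [v0]. If [x] sends [v0] to
    the new entry, acting on the product with [v0] in that place gives terms hit before [k], in [W]
    by induction, and a positive number of copies of the wanted product. *)
Lemma sym_rep_generated (v0 : V) (W : symp n V -> Prop) :
  (forall w, exists x, rho x v0 = w) -> is_subspace W ->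
  (forall x m, W m -> W (sym_rep n rho x m)) -> W (spow n v0) -> forall m, W m.
Proof.
move=> surj subW Wx Wv0; have [W0 Wl] := subW; apply: symp_ind => // f.
have WD u v : W u -> W v -> W (u + v) by move=> *; rewrite -[u]scale1r; apply: Wl.
have WN u v : W (u + v) -> W u -> W v.
  by move=> Wuv Wu; rewrite -[v](addKr u) -scaleN1r; apply: Wl.
suff H k : forall f : {ffun 'I_n -> V},
    (forall i : 'I_n, (k <= i)%N -> f i = v0) -> W (sprod f).
  by apply: (H n) => i; rewrite leqNgt ltn_ord.
elim: k => [|k IH] {}f fv0.
  rewrite (_ : f = [ffun=> v0]) //; apply/ffunP => i; rewrite ffunE; exact: fv0.
have [lek|ltk] := leqP n k.
  by apply: IH => i; rewrite leqNgt (leq_trans (ltn_ord i) lek).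
pose i := Ordinal ltk; have [x xv] := surj (f i).
pose f0 := upd f i v0.
have f0v0 (j : 'I_n) : (k <= j)%N -> f0 j = v0.
  move=> kj; have [->|ji] := eqVneq j i; first by rewrite upd_at.
  by rewrite upd_out //; apply: fv0; rewrite ltn_neqAle kj andbT eq_sym.
have := Wx x _ (IH f0 f0v0); rewrite sym_repE (bigID (fun j : 'I_n => (j < k)%N)) /=.
move=> /WN WS; have {}WS := WS _.
have {WS} : W (\sum_(j < n | ~~ (j < k)%N) sprod (upd f0 j (rho x (f0 j)))).
  apply: WS; elim/big_ind: _ => // j ltj; apply: IH => l kl.
  rewrite upd_out; first exact: f0v0.
  by apply: contraTneq kl => ->; rewrite -ltnNge.
rewrite (eq_bigr (fun=> sprod f)) => [|j]; last first.
  rewrite -leqNgt => kj; rewrite (f0v0 j kj) xv.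
  (* A hit at a later [j] is moved to position [i] by a transposition, as the entries there are both
     [v0]. *)
  rewrite -[RHS](sprod_perm _ (tperm i j)); congr sprod; apply/ffunP => l.
  rewrite !ffunE; case: tpermP => [->|->|/eqP li /eqP lj].
  - rewrite eqxx; case: eqP => [->//|/eqP ij].
    apply/esym/fv0; rewrite ltn_neqAle kj andbT; by rewrite -val_eqE in ij.
  - by rewrite eqxx.
  by rewrite (negPf li) (negPf lj).
rewrite sumr_const; set d := #|_|.
have d0 : (0 < d)%N.
  by apply/card_gt0P; exists i; rewrite unfold_in /= ltnn.
move=> Wd; rewrite -[sprod f]scale1r -(mulVf (x := d%:R : K)) ?pnatr_eq0 -?lt0n //.
by rewrite -scalerA scaler_nat -[_ *: _]addr0; apply: Wl.
Qed.
End SymmetricPowerFacts.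

(** * Weights and generation of the symmetric power of V ⊗ A *)

Section SymmetricPowerHighestWeight.
Variables (K : numFieldType) (A0 : comPzRingType) (iota : {rmorphism K -> A0}).
Variables (r n : nat).
Local Notation A := (alg_of iota).
Local Notation slr := (sl K r.+1).
Local Notation VA := (tensor 'cV[K]_r.+1 A).
Local Notation rhoV := (tensor_rep iota (vec_rep K r.+1)).
Local Notation e_ k := (delta_mx k ord0 : 'cV[K]_r.+1).

(** The weight of a product of basis tensors whose vector parts have indices [t i]. *)
Definition sympower_weight_fun (t : {ffun 'I_n -> 'I_r.+1}) (h : cartan K r) : K :=
  \sum_i (h : 'M[K]_r.+1) (t i) (t i).
Fact sympower_weight_scalar t : scalar (sympower_weight_fun t).
Proof.
move=> a u v; rewrite /sympower_weight_fun mulr_sumr -big_split /=.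
by apply: eq_bigr => i _; rewrite !mxE.
Qed.
HB.instance Definition _ t := GRing.isLinear.Build K (cartan K r) K _
  (sympower_weight_fun t) (sympower_weight_scalar t).
Definition sympower_weight t : weight K r := sympower_weight_fun t.

Lemma sympower_weight_integral t : integral_weight (sympower_weight t).
Proof.
move=> i; rewrite /sympower_weight /= /sympower_weight_fun.
elim/big_ind: _ => [|x y [z ->] [z' ->]|k _].
- by exists 0.
- by exists (z + z'); rewrite rmorphD.
rewrite /= !mxE !andbb.
exists ((t k == widen_ord (leqnSn r) i)%:R - (t k == lift ord0 i)%:R).
by rewrite rmorphB !rmorph_nat.
Qed.

Lemma tensor_rep_basis (x : slr) (Q P : A) k :
  rhoV (x ⊗t Q) (e_ k ⊗t P) = (col k (x : 'M_r.+1)) ⊗t (Q * P).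
Proof. by rewrite tensor_repE /= colE. Qed.

Lemma tensor_rep_cartan (h : cartan K r) k (P : A) :
  rhoV ((h : slr) ⊗t (1 : A)) (e_ k ⊗t P) = (h : 'M_r.+1) k k *: (e_ k ⊗t P).
Proof.
have hk : col k (h : 'M_r.+1) = (h : 'M_r.+1) k k *: e_ k.
  apply/colP => i; rewrite !mxE andbT.
  have [->|ik] := eqVneq i k; first by rewrite mulr1.
  by rewrite mulr0; have /is_diag_mxP -> := cartan_diag h.
by rewrite tensor_rep_basis mul1r hk (linear_funZ (tens_linl P)).
Qed.

Definition basis_tensor (y : VA) : Prop := exists k P, y = e_ k ⊗t P.

Lemma basis_tensor_span (X : VA -> Prop) : is_subspace X ->
  (forall y, basis_tensor y -> X y) -> forall y, X y.
Proof.
move=> subX Xb; have [X0 Xl] := subX; apply: tensor_ind => // w P.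
rewrite [w]matrix_sum_delta (linear_fun_sum (tens_linl P)).
have XD u v : X u -> X v -> X (u + v) by move=> *; rewrite -[u]scale1r; apply: Xl.
elim/big_ind: _ => // i _; rewrite big_ord1 (linear_funZ (tens_linl P)).
by rewrite -[_ *: _]addr0; apply: Xl => //; apply: Xb; exists i, P.
Qed.

Lemma sympower_basis_weight (t : {ffun 'I_n -> 'I_r.+1}) (f : {ffun 'I_n -> VA})
    (h : cartan K r) : (forall i, exists P, f i = e_ (t i) ⊗t P) ->
  sym_rep n rhoV ((h : slr) ⊗t (1 : A)) (sprod f) = sympower_weight t h *: sprod f.
Proof.
move=> tP; rewrite (sym_rep_eigen (a := fun i => (h : 'M_r.+1) (t i) (t i))) //.
by move=> i; have [P ->] := tP i; rewrite tensor_rep_cartan.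
Qed.

Lemma sympower_integrable : integrable (rep_at1 (sym_rep n rhoV)).
Proof.
apply: (integrable_of_weight_vectors sympower_weight_integral).
apply: (symp_ind_gen basis_tensor_span).
  split=> [|a u v [c [cw ->]] [d [dw ->]]].
    exists (fun=> 0); split=> [j h|]; last by rewrite big1.
    by rewrite (linear_fun0 (lact_linr _ _)) scaler0.
  exists (fun j => a *: c j + d j); split=> [j h|].
    by rewrite lact_linr cw dw scalerDr !scalerA mulrC.
  by rewrite big_split scaler_sumr.
move=> f fb; have [t tP] := choice fb.
exists (fun j => if j == [ffun i => t i] then sprod f else 0); split.
  move=> j h; case: eqP => [->|_]; last first.
    by rewrite (linear_fun0 (lact_linr _ _)) scaler0.
  apply: sympower_basis_weight => i; rewrite ffunE; exact: tP.
by rewrite -big_mkcond big_pred1_eq.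
Qed.

Let v0 : VA := e_ ord0 ⊗t (1 : A).

(** Each basis vector is column 0 of a traceless matrix; for index 0 the trace is compensated at the
    second diagonal place, available since [0 < r]. *)
Lemma sympower_surj : (0 < r)%N -> forall y, exists x, rhoV x v0 = y.
Proof.
move=> r_gt0; pose i1 : 'I_r.+1 := Ordinal (r_gt0 : (1 < r.+1)%N).
apply: basis_tensor_span.
  split=> [|a u v [x <-] [y <-]].
    by exists 0; rewrite (linear_fun0 (lact_linl _ _)).
  by exists (a *: x + y); rewrite lact_linl.
move=> _ [k [P ->]].
have [x xk] : exists x : slr, col ord0 (x : 'M_r.+1) = e_ k.
  have [->|k0] := eqVneq k ord0.
    exists (sl_diag K ord0 i1); apply/colP => i; rewrite !mxE !eqxx !andbT.
    have -> : (ord0 == i1 :> 'I_r.+1) = false by [].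
    by rewrite andbF sub0r opprK subrK.
  exists (sl_unit K k ord0); apply/colP => i; rewrite !mxE eqxx andbT (negPf k0).
  by rewrite mul0r mul0rn subr0.
by exists (x ⊗t P); rewrite /v0 tensor_rep_basis xk mulr1.
Qed.

Lemma sympower_highest_weight : (0 < r)%N ->
  highest_weight_module (weight_muln omega1 n) (sym_rep n rhoV) (spow n v0).
Proof.
move=> r_gt0; split.
- exact: sympower_integrable.
- move=> W subW Wx Wv; apply: (sym_rep_generated (sympower_surj r_gt0) subW Wx Wv).
- move=> x P xn; rewrite (sym_rep_eigen (a := fun=> 0)).
    by rewrite big1 ?scale0r.
  move=> i; rewrite ffunE scale0r tensor_rep_basis.
  rewrite (_ : col ord0 _ = 0) ?(linear_fun0 (tens_linl _)) //.
  by apply/colP => j; rewrite !mxE xn.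
move=> h; rewrite (sym_rep_eigen (a := fun=> (h : 'M_r.+1) ord0 ord0)).
  by rewrite sumr_const card_ord.
by move=> i; rewrite ffunE tensor_rep_cartan.
Qed.
End SymmetricPowerHighestWeight.

(** * Uniqueness of global Weyl modules and the isomorphism *)

Section RepHom.
Variables (K : fieldType) (A0 : comPzRingType) (iota : {rmorphism K -> A0}).
Variables (r : nat).
Local Notation gA := (tensor (sl K r.+1) (alg_of iota)).
Variables (M N : lmodType K) (rho : lie_rep gA M) (sigma : lie_rep gA N).

Lemma rep_hom_surj (f : {linear M -> N}) w u : rep_hom rho sigma f -> f w = u ->
  generated_by sigma u -> forall y, exists x, f x = y.
Proof.
move=> fhom fw gen; apply: gen; last by exists w.
- split=> [|a u1 u2 [x <-] [y <-]]; first by exists 0; rewrite linear0.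
  by exists (a *: x + y); rewrite linearP.
by move=> x _ [y <-]; exists (rho x y); rewrite fhom.
Qed.

(** Maximality gives morphisms in both directions exchanging the generators; their composites fix
    the generators, hence are identities. *)
Lemma global_weyl_module_unique (lam : weight K r) w u :
  global_weyl_module lam rho w -> global_weyl_module lam sigma u ->
  exists f : {linear M -> N}, [/\ rep_hom rho sigma f, bijective f & f w = u].
Proof.
move=> [hM univM] [hN univN].
have [f [fhom fw _]] := univM _ _ _ hN; have [f' [f'hom f'u _]] := univN _ _ _ hM.
exists f; split=> //; exists f' => y.
  have [_ gen _ _] := hM; move: y; apply: gen.
  - split=> [|a x y fx fy]; first by rewrite !linear0.
    by rewrite !linearP fx fy.
  - by move=> x m fm; rewrite fhom f'hom fm.
  - by rewrite fw f'u.
have [_ gen _ _] := hN; move: y; apply: gen.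
- split=> [|a x y fx fy]; first by rewrite !linear0.
  by rewrite !linearP fx fy.
- by move=> x m fm; rewrite f'hom fhom fm.
- by rewrite f'u fw.
Qed.
End RepHom.

Lemma sympower_global_weyl (K : numFieldType) (A0 : comPzRingType)
    (iota : {rmorphism K -> A0}) (r n : nat) : (0 < r)%N ->
  global_weyl_module (weight_muln omega1 n)
    (sym_rep n (tensor_rep iota (vec_rep K r.+1)))
    (spow n ((delta_mx ord0 ord0 : 'cV[K]_r.+1) ⊗t (1 : alg_of iota))).
Proof.
move=> r_gt0; split; first exact: sympower_highest_weight.
move=> N sigma u hu.
pose i1 : 'I_r.+1 := Ordinal (r_gt0 : (1 < r.+1)%N).
have [Phi [Phom Phiu]] := hwm_from_sympower (isT : i1 != ord0) hu.
exists Phi; split=> //.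
by have [_ gen _ _] := hu; apply: (rep_hom_surj Phom Phiu gen).
Qed.

Theorem theorem6 (R : realType) (A : comPzRingType)
    (iota : {rmorphism R[i] -> A}) (r n : nat) (hr : (0 < r)%N) :
  let gA := (sl R[i] r.+1 ⊗ alg_of iota)%type in
  let VA := ('cV[R[i]]_r.+1 ⊗ alg_of iota)%type in
  let rhoS := sym_rep n (tensor_rep iota (vec_rep R[i] r.+1)) in
  let vS : symp n VA :=
    spow n ((delta_mx ord0 ord0 : 'cV[R[i]]_r.+1) ⊗t (1 : alg_of iota)) in
  (exists (W : lmodType R[i]) (rhoW : lie_rep gA W) (vW : W),
     global_weyl_module (weight_muln omega1 n) rhoW vW) /\
  (forall (W : lmodType R[i]) (rhoW : lie_rep gA W) (vW : W),
     global_weyl_module (weight_muln omega1 n) rhoW vW ->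
     exists phi : {linear W -> symp n VA},
       [/\ rep_hom rhoW rhoS phi, bijective phi & phi vW = vS]).
Proof.
move=> gA VA rhoS vS.
have weylS : global_weyl_module (weight_muln omega1 n) rhoS vS.
  exact: sympower_global_weyl.
split; first by exists (symp n VA), rhoS, vS.
move=> W rhoW vW weylW.
have [f [fhom fbij fv]] := global_weyl_module_unique weylW weylS.
by exists f; split; [exact fhom | exact fbij | exact fv].
Qed.
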